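(* Let $\Theta$ be a classical-quantum channel mapping each input symbol $x$ of a finite alphabet $\mathcal{X}$ to a quantum state $\theta_x$. For every $\varepsilon>0$ the following hold. (Public communication.) If $\theta_x=\theta_x^Y$ is a state of the receiver's system $Y$, then $$C_{\rm pub}^{\varepsilon}(\Theta)\geq \max_{P_X}\Big[H_{\min}^{\varepsilon/8}(X)-H_{\max}^{\varepsilon/8}(X|Y)-4\log\tfrac{1}{\varepsilon}-16\Big],$$ $$C_{\rm pub}^{\varepsilon}(\Theta)\leq \max_{P_X}\Big[H_{\min}(X)-H_{\max}^{\sqrt{2\varepsilon}}(X|Y)\Big],$$ where the entropies are evaluated on the classical-quantum state $\psi^{XY}=\sum_x P_X(x)\,|x\rangle\langle x|^X\otimes\theta_x^Y$. (Private communication.) If $\theta_x=\theta_x^{YZ}$ is a bipartite state whose $Y$ part goes to the receiver and whose $Z$ part goes to an eavesdropper, then $$C_{\rm prv}^{8\varepsilon}(\Theta)\geq\max_{P_T,\,T\rightarrow X}\Big[H_{\min}^{\varepsilon/8}(T|Z)-H_{\max}^{\varepsilon/8}(T|Y)-4\log\tfrac{1}{\varepsilon}-16\Big],$$ $$C_{\rm prv}^{\varepsilon}(\Theta)\leq \max_{P_T,\,T\rightarrow X}\Big[H_{\min}^{\sqrt{2\varepsilon}}(T|Z)-H_{\max}^{\sqrt{2\varepsilon}}(T|Y)\Big],$$ where the maximizations run over finite random variables $T$ with distribution $P_T$ and stochastic maps $P_{X|T}$ (so that $T\to X\to(Y,Z)$ is a Markov chain), and the entropies are evaluated on the state $\sum_t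 P_T(t)\,|t\rangle\langle t|^T\otimes\sum_x P_{X|T}(x|t)\,\theta_x^{YZ}$ and its reductions.
   Context: All logarithms are base 2. An $(n,\varepsilon)$-coding scheme for $\Theta$ consists of an encoder $\mathsf{Enc}:\mathcal{M}\to\mathcal{X}$ on a finite message set $\mathcal{M}$ with $n=\log_2|\mathcal{M}|$ and a decoder $\mathsf{Dec}$ (a measurement on the output system $Y$ with outcomes in $\mathcal{M}$) such that for every $m\in\mathcal{M}$, $p_{\rm error}(m)=\Pr[m\neq \mathsf{Dec}(\Theta(\mathsf{Enc}(m)))]\leq\varepsilon$. An $(n,\varepsilon)$-private coding scheme additionally satisfies, for every $m$, $p_{\rm secret}(m)=\tfrac12\|\theta^Z_{\mathsf{Enc}(m)}-\theta^Z\|_1\leq\varepsilon$, where $\theta^Z=2^{-n}\sum_m\theta^Z_{\mathsf{Enc}(m)}$ and $\theta^Z_x$ is the $Z$-marginal of $\theta^{YZ}_x$ (the encoder may be randomized, in which case $\theta_{\mathsf{Enc}(m)}$ denotes the averaged output). $C^\varepsilon_{\rm pub}(\Theta)$ (resp. $C^\varepsilon_{\rm prv}(\Theta)$) is the largest $n$ for which an $(n,\varepsilon)$-coding scheme (resp. private coding scheme) exists. Entropies: for a state $\rho^{AB}$, $H_{\max}(A|B)_\rho=\max_{\sigma^B}2\log F(\rho^{AB},\mathbb{1}^A\otimes\sigma^B)$ with $F(\rho,\sigma)=\|\sqrt\rho\sqrt\sigma\|_1$, and $H_{\min}(A|B)_\rho=\max_{\sigma^B}\big(-\log\min\{\lambda:\rho^{AB}\leq\lambda\,\mathbb{1}^A\otimes\sigma^B\}\big)$,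 maximizations over normalized states $\sigma^B$; unconditional entropies $H_{\min}(A)$, $H_{\max}(A)$ are the case of trivial $B$. With purification distance $P(\rho,\sigma)=\sqrt{1-F(\rho,\sigma)^2}$ and $B_\epsilon(\rho)=\{\bar\rho\text{ (possibly subnormalized)}:P(\rho,\bar\rho)\leq\epsilon\}$, the smooth entropies are $H_{\min}^\epsilon(A|B)_\rho=\max_{\bar\rho\in B_\epsilon(\rho)}H_{\min}(A|B)_{\bar\rho}$ and $H_{\max}^\epsilon(A|B)_\rho=\min_{\bar\rho\in B_\epsilon(\rho)}H_{\max}(A|B)_{\bar\rho}$. *)

(* Defs.v *)
From HB Require Import structures.
From mathcomp Require Import all_boot all_order all_algebra.
From mathcomp Require Import complex mxtens.
From mathcomp Require Import boolp classical_sets reals constructive_ereal ereal exp.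
Set Implicit Arguments. Unset Strict Implicit. Unset Printing Implicit Defensive.
Import Order.TTheory GRing.Theory Num.Theory.
Local Open Scope ring_scope.
Local Open Scope complex_scope.
Local Open Scope classical_set_scope.

Section QInfo.
Variable R : realType.
Local Notation C := R[i].

Definition adjm {m n} (A : 'M[C]_(m, n)) : 'M[C]_(n, m) :=
  \matrix_(i, j) conjc (A j i).

Definition psd {n} (A : 'M[C]_n) : Prop :=
  adjm A = A /\ forall v : 'rV[C]_n, 0 <= (v *m A *m adjm v) 0 0.

Definition loew {n} (A B : 'M[C]_n) : Prop := psd (B - A).

Definition trR {n} (A : 'M[C]_n) : R := @complex.Re R (\tr A).

Definition qstate {n} (A : 'M[C]_n) : Prop := psd A /\ \tr A = 1.
Definition subnormalized {n} (A : 'M[C]_n) : Prop := psd A /\ trR A <= 1.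

Definition sqrtm {n} (A : 'M[C]_n) : 'M[C]_n :=
  xget 0 [set X : 'M[C]_n | psd X /\ X *m X = A].

Definition tnorm {m} (A : 'M[C]_m) : R := trR (sqrtm (adjm A *m A)).

Definition fid {n} (rho sigma : 'M[C]_n) : R := tnorm (sqrtm rho *m sqrtm sigma).

Definition pdist {n} (rho sigma : 'M[C]_n) : R :=
  Num.sqrt (1 - fid rho sigma ^+ 2).

Definition sball {n} (eps : R) (rho : 'M[C]_n) : set 'M[C]_n :=
  [set rb | subnormalized rb /\ pdist rho rb <= eps].

Definition lg2 (x : R) : R := ln x / ln 2.
Definition elg2 (x : \bar R) : \bar R :=
  match x with
  | EFin r => if r <= 0 then -oo%E else (lg2 r)%:E
  | +oo%E => +oo%E
  | -oo%E => -oo%E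
  end.

Definition ptr2 {m n} (A : 'M[C]_(m * n)) : 'M[C]_m :=
  \matrix_(i, j) \sum_(k < n) A (mxtens_index (i, k)) (mxtens_index (j, k)).
Definition ptr1 {m n} (A : 'M[C]_(m * n)) : 'M[C]_n :=
  \matrix_(i, j) \sum_(k < m) A (mxtens_index (k, i)) (mxtens_index (k, j)).

Definition ptrZ {a b c} (A : 'M[C]_(a * (b * c))) : 'M[C]_(a * b) :=
  \matrix_(i, j) \sum_(z < c)
     A (mxtens_index ((mxtens_unindex i).1, mxtens_index ((mxtens_unindex i).2, z)))
       (mxtens_index ((mxtens_unindex j).1, mxtens_index ((mxtens_unindex j).2, z))).
Definition ptrY {a b c} (A : 'M[C]_(a * (b * c))) : 'M[C]_(a * c) :=
  \matrix_(i, j) \sum_(y < b)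
     A (mxtens_index ((mxtens_unindex i).1, mxtens_index (y, (mxtens_unindex i).2)))
       (mxtens_index ((mxtens_unindex j).1, mxtens_index (y, (mxtens_unindex j).2))).

Definition Hmin {dA dB} (rho : 'M[C]_(dA * dB)) : \bar R :=
  ereal_sup [set (- elg2 (ereal_inf
       [set (lam%:E)%E | lam in [set lam : R | loew rho (lam%:C *: (tensmx (1%:M : 'M[C]_dA) sigma))]]))%E
    | sigma in [set sigma : 'M[C]_dB | qstate sigma]].

Definition Hmax {dA dB} (rho : 'M[C]_(dA * dB)) : \bar R :=
  ereal_sup [set (2%:E * elg2 (fid rho (tensmx (1%:M : 'M[C]_dA) sigma))%:E)%E
    | sigma in [set sigma : 'M[C]_dB | qstate sigma]].

Definition HminU {d} (rho : 'M[C]_d) : \bar R :=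
  (- elg2 (ereal_inf [set (lam%:E)%E | lam in [set lam : R | loew rho (lam%:C *: (1%:M : 'M[C]_d))]]))%E.

Definition sHmin {dA dB} (eps : R) (rho : 'M[C]_(dA * dB)) : \bar R :=
  ereal_sup [set Hmin rb | rb in sball eps rho].
Definition sHmax {dA dB} (eps : R) (rho : 'M[C]_(dA * dB)) : \bar R :=
  ereal_inf [set Hmax rb | rb in sball eps rho].
Definition sHminU {d} (eps : R) (rho : 'M[C]_d) : \bar R :=
  ereal_sup [set HminU rb | rb in sball eps rho].

Definition isdistr (T : finType) (P : T -> R) : Prop :=
  (forall t, 0 <= P t) /\ \sum_t P t = 1.

Definition cqstate (T : finType) {d} (P : T -> R) (th : T -> 'M[C]_d)
  : 'M[C]_(#|T| * d) :=
  \sum_(x : T) (P x)%:C *: (tensmx (delta_mx (enum_rank x) (enum_rank x)) (th x)).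

Definition povm {k d} (D : 'I_k -> 'M[C]_d) : Prop :=
  (forall m, psd (D m)) /\ \sum_(m < k) D m = 1%:M.

Definition perr {X : finType} {k d} (th : X -> 'M[C]_d) (enc : 'I_k -> X)
  (D : 'I_k -> 'M[C]_d) (m : 'I_k) : R := 1 - trR (D m *m th (enc m)).

Definition pub_code {X : finType} {d} (eps : R) (th : X -> 'M[C]_d) (k : nat) : Prop :=
  exists (enc : 'I_k -> X) (D : 'I_k -> 'M[C]_d),
    povm D /\ forall m, perr th enc D m <= eps.

Definition Cpub {X : finType} {d} (eps : R) (th : X -> 'M[C]_d) : \bar R :=
  ereal_sup [set (lg2 k%:R)%:E | k in [set k : nat | (0 < k)%N /\ pub_code eps th k]].

Definition encout {X : finType} {k d} (th : X -> 'M[C]_d) (E : 'I_k -> X -> R)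
  (m : 'I_k) : 'M[C]_d := \sum_(x : X) (E m x)%:C *: th x.

Definition prv_code {X : finType} {dY dZ} (eps : R) (th : X -> 'M[C]_(dY * dZ))
  (k : nat) : Prop :=
  exists (E : 'I_k -> X -> R) (D : 'I_k -> 'M[C]_dY),
    (forall m, isdistr (E m)) /\ povm D /\
    (forall m, 1 - trR (D m *m ptr2 (encout th E m)) <= eps) /\
    (forall m, tnorm (ptr1 (encout th E m)
                      - (k%:R)^-1 *: \sum_(m' < k) ptr1 (encout th E m')) / 2 <= eps).

Definition Cprv {X : finType} {dY dZ} (eps : R) (th : X -> 'M[C]_(dY * dZ)) : \bar R :=
  ereal_sup [set (lg2 k%:R)%:E | k in [set k : nat | (0 < k)%N /\ prv_code eps th k]].

Definition tstate {X : finType} {t dY dZ} (PT : 'I_t -> R) (W : 'I_t -> X -> R)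
  (th : X -> 'M[C]_(dY * dZ)) : 'M[C]_(#|'I_t| * (dY * dZ)) :=
  cqstate PT (fun tau => \sum_(x : X) (W tau x)%:C *: th x).

End QInfo.

(* Main.v *)
(** Converse.  Let [D] be the decoder of a code and let [T] be uniform on its
    messages.  Measuring gently with [sqrt D] moves [psi^TY] by at most
    [sqrt (2 eps)] in purified distance, to a state whose fidelity with every
    [1 (x) sigma] is at most [1] by Hoelder's inequality; its max-entropy is
    therefore nonpositive.  Secrecy makes [psi^TZ] close to
    [1/k (x) theta^Z], whose min-entropy given [Z] is [log k].

    Achievability.  The bound [F(rb, 1 (x) psi^Y)^2 <= mu] on the smoothed state
    and the Powers-Stormer inequality give effects [Lam t] that accept
    [theta_t] while [sum_t tr (Lam t psi^Y) <= mu / e].  A uniformly random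
    binning of the inputs into about [mu / e^2] bins makes the elements of a bin
    distinguishable by the square-root measurement, through the
    Hayashi-Nagaoka inequality.  For public coding, the largest set of
    decodable inputs in one bin is a code, its size being bounded below through
    the smooth min-entropy.  For private coding, a random hash value is joined
    to the bin index; by the leftover hash lemma the pair is nearly uniform and
    independent of [Z], and encoding message [m] by an input drawn conditionally
    on hash value [m] and a good bin, after discarding the worse half of the
    messages, gives a private code. *)
Require Import Defs.
From HB Require Import structures.
From mathcomp Require Import all_boot all_order all_algebra.
From mathcomp Require Import complex mxtens spectral sesquilinear.
From mathcomp Require Import ring lra.
From mathcomp Require Import boolp classical_sets reals constructive_ereal ereal exp.
Set Implicit Arguments. Unset Strict Implicit. Unset Printing Implicit Defensive.
Import Order.TTheory GRing.Theory Num.Theory.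
Local Open Scope ring_scope.
Local Open Scope complex_scope.
Local Open Scope classical_set_scope.

(** * Positive semidefinite matrices *)

(** Trace-norm estimates rest on duality: [tnorm A] is the maximum of [trR (K *m A)] over
    contractions [K]. This gives the triangle, Hoelder and measurement inequalities without polar
    decompositions or purifications. In the achievability proofs the purified distance enters only
    through acceptance probabilities of effects ([pdist_meas]), so a smoothed state need not inherit
    the block structure of the state that it approximates.

    A code must serve every message, while a random choice controls only averages. Both codes
    therefore discard: the public one keeps the inputs whose error bound is at most [eps], the
    private one the messages whose error and leakage are jointly small. With binning, distinct
    public messages are distinct inputs, so a min-entropy bound counts them directly. For private
    codes one random function yields both the hash value and the bin, so one averaging argument
    controls secrecy and decoding together.

    Inverse square roots are taken only of invertible operators: a small multiple of the identity is
    added first, at a cost independent of the dimension. *)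

Section MatrixAnalysis.
Variable R : realType.
Local Notation C := R[i].
Local Notation Rpart := (@complex.Re R).

Lemma ReD (x y : C) : Rpart (x + y) = Rpart x + Rpart y.
Proof. by case: x; case: y. Qed.
Lemma ReN (x : C) : Rpart (- x) = - Rpart x.
Proof. by case: x. Qed.
Lemma ReZ (a : R) (x : C) : Rpart (a%:C * x) = a * Rpart x.
Proof. by case: x => u v /=; rewrite mul0r subr0. Qed.
Lemma ReJ (x : C) : Rpart (conjc x) = Rpart x.
Proof. by case: x. Qed.
Lemma Re_sum (I : Type) (r : seq I) (P : pred I) (F : I -> C) :
  Rpart (\sum_(i <- r | P i) F i) = \sum_(i <- r | P i) Rpart (F i).
Proof. by apply: (big_morph _ ReD). Qed.
Lemma ReMJ_ge0 (x : C) : 0 <= Rpart (x * conjc x).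
Proof. by case: x => a b /=; rewrite mulrN opprK addr_ge0 // -expr2 sqr_ge0. Qed.
Lemma cplx_ge0 (x : C) : (0 <= x) = (0 <= Rpart x) && (conjc x == x).
Proof.
case: x => a b; rewrite lecE eq_complex /= eqxx /= andbC; congr (_ && _).
by rewrite [in RHS]eq_sym -[in RHS]addr_eq0 -mulr2n mulrn_eq0.
Qed.

Lemma adjmE m n (A : 'M[C]_(m, n)) i j : adjm A i j = conjc (A j i).
Proof. by rewrite mxE. Qed.
Lemma adjmK m n (A : 'M[C]_(m, n)) : adjm (adjm A) = A.
Proof. by apply/matrixP => i j; rewrite !mxE conjcK. Qed.
Lemma adjmM m n p (A : 'M[C]_(m, n)) (B : 'M[C]_(n, p)) :
  adjm (A *m B) = adjm B *m adjm A.
Proof.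
apply/matrixP => i j; rewrite !mxE rmorph_sum; apply: eq_bigr => k _.
by rewrite !mxE rmorphM mulrC.
Qed.
Lemma adjmD m n (A B : 'M[C]_(m, n)) : adjm (A + B) = adjm A + adjm B.
Proof. by apply/matrixP => i j; rewrite !mxE rmorphD. Qed.
Lemma adjmN m n (A : 'M[C]_(m, n)) : adjm (- A) = - adjm A.
Proof. by apply/matrixP => i j; rewrite !mxE rmorphN. Qed.
Lemma adjmB m n (A B : 'M[C]_(m, n)) : adjm (A - B) = adjm A - adjm B.
Proof. by rewrite adjmD adjmN. Qed.
Lemma adjm0 m n : adjm (0 : 'M[C]_(m, n)) = 0.
Proof. by apply/matrixP => i j; rewrite !mxE rmorph0. Qed.
Lemma adjmZ m n (a : R) (A : 'M[C]_(m, n)) : adjm (a%:C *: A) = a%:C *: adjm A.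
Proof. by apply/matrixP => i j; rewrite !mxE rmorphM /= oppr0. Qed.
Lemma adjm1 n : adjm (1%:M : 'M[C]_n) = 1%:M.
Proof. by apply/matrixP => i j; rewrite !mxE eq_sym rmorph_nat. Qed.
Lemma adjm_sum m n (I : Type) (r : seq I) (P : pred I) (F : I -> 'M[C]_(m, n)) :
  adjm (\sum_(i <- r | P i) F i) = \sum_(i <- r | P i) adjm (F i).
Proof. by apply: (big_morph _ (@adjmD m n) (adjm0 m n)). Qed.
Lemma mxtrace_adjm n (A : 'M[C]_n) : \tr (adjm A) = conjc (\tr A).
Proof. by rewrite /mxtrace rmorph_sum; apply: eq_bigr => i _; rewrite mxE. Qed.

Lemma trRD n (A B : 'M[C]_n) : trR (A + B) = trR A + trR B.
Proof. by rewrite /trR mxtraceD ReD. Qed.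
Lemma trRN n (A : 'M[C]_n) : trR (- A) = - trR A.
Proof. by rewrite /trR raddfN ReN. Qed.
Lemma trRB n (A B : 'M[C]_n) : trR (A - B) = trR A - trR B.
Proof. by rewrite trRD trRN. Qed.
Lemma trR0 n : trR (0 : 'M[C]_n) = 0.
Proof. by rewrite /trR mxtrace0. Qed.
Lemma trRZ n (a : R) (A : 'M[C]_n) : trR (a%:C *: A) = a * trR A.
Proof. by rewrite /trR mxtraceZ ReZ. Qed.
Lemma trRC m n (A : 'M[C]_(m, n)) (B : 'M[C]_(n, m)) : trR (A *m B) = trR (B *m A).
Proof. by rewrite /trR mxtrace_mulC. Qed.
Lemma trR_adjm n (A : 'M[C]_n) : trR (adjm A) = trR A.
Proof. by rewrite /trR mxtrace_adjm ReJ. Qed.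
Lemma trR_sum n (I : Type) (r : seq I) (P : pred I) (F : I -> 'M[C]_n) :
  trR (\sum_(i <- r | P i) F i) = \sum_(i <- r | P i) trR (F i).
Proof. by apply: (big_morph _ (@trRD n) (trR0 n)). Qed.
Lemma trRE n (A : 'M[C]_n) : trR A = \sum_i Rpart (A i i).
Proof. by rewrite /trR Re_sum. Qed.
Lemma trR1 n : trR (1%:M : 'M[C]_n) = n%:R.
Proof.
rewrite trRE (eq_bigr (fun=> 1)) ?sumr_const ?card_ord // => i _.
by rewrite mxE eqxx.
Qed.

(** The quadratic form of a Hermitian matrix is real, so only its real part needs a sign. This keeps
    positivity arguments in [R]. *)
Lemma psdP n (A : 'M[C]_n) :
  psd A <-> adjm A = A /\ forall v : 'rV[C]_n, 0 <= Rpart ((v *m A *m adjm v) 0 0).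
Proof.
split=> -[hA pA]; split=> // v; have := pA v.
  by rewrite cplx_ge0 => /andP[].
move=> h; rewrite cplx_ge0 h /= -adjmE.
by rewrite !adjmM hA adjmK mulmxA.
Qed.

Lemma psd_herm n (A : 'M[C]_n) : psd A -> adjm A = A. Proof. by case. Qed.
Lemma psd0 n : psd (0 : 'M[C]_n).
Proof. by split=> [|v]; rewrite ?adjm0 // mulmx0 mul0mx mxE. Qed.
Lemma psdD n (A B : 'M[C]_n) : psd A -> psd B -> psd (A + B).
Proof.
move=> /psdP[hA pA] /psdP[hB pB]; apply/psdP; split; first by rewrite adjmD hA hB.
by move=> v; rewrite mulmxDr mulmxDl mxE ReD addr_ge0.
Qed.
Lemma psdZ n (a : R) (A : 'M[C]_n) : 0 <= a -> psd A -> psd (a%:C *: A).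
Proof.
move=> a0 /psdP[hA pA]; apply/psdP; split; first by rewrite adjmZ hA.
by move=> v; rewrite -scalemxAr -scalemxAl mxE ReZ mulr_ge0.
Qed.
Lemma psd_sum n (I : Type) (r : seq I) (P : pred I) (F : I -> 'M[C]_n) :
  (forall i, P i -> psd (F i)) -> psd (\sum_(i <- r | P i) F i).
Proof. by move=> h; apply: big_ind; [exact: psd0|exact: psdD|exact: h]. Qed.
Lemma psd_conj m n (M : 'M[C]_(m, n)) (A : 'M[C]_n) : psd A -> psd (M *m A *m adjm M).
Proof.
move=> /psdP[hA pA]; apply/psdP; split; first by rewrite !adjmM hA adjmK mulmxA.
by move=> v; have := pA (v *m M); rewrite adjmM !mulmxA.
Qed.
Lemma hsE m n (A : 'M[C]_(m, n)) : 0 <= trR (A *m adjm A).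
Proof.
rewrite trRE sumr_ge0 // => i _; rewrite mxE Re_sum sumr_ge0 // => j _.
by rewrite mxE ReMJ_ge0.
Qed.
Lemma psd_gram m n (M : 'M[C]_(m, n)) : psd (M *m adjm M).
Proof.
apply/psdP; split; first by rewrite adjmM adjmK.
move=> v; have := hsE (v *m M); rewrite adjmM !mulmxA trRE big_ord1.
by [].
Qed.
Lemma psd_gramV m n (M : 'M[C]_(m, n)) : psd (adjm M *m M).
Proof. by rewrite -{2}[M]adjmK; apply: psd_gram. Qed.
Lemma psd1 n : psd (1%:M : 'M[C]_n).
Proof. by have := psd_gram (1%:M : 'M[C]_n); rewrite adjm1 mulmx1. Qed.

Local Opaque psd.

Lemma loew_refl n (A : 'M[C]_n) : loew A A.
Proof. by rewrite /loew subrr; apply: psd0. Qed.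
Lemma loew_trans n (A B D : 'M[C]_n) : loew A B -> loew B D -> loew A D.
Proof. by move=> h1 h2; have := psdD h1 h2; rewrite addrC addrA subrK. Qed.

(** * Spectral calculus and square roots *)

Definition unitary n (V : 'M[C]_n) := adjm V *m V = 1%:M /\ V *m adjm V = 1%:M.

(** Functional calculus in a fixed eigenbasis: for unitary [V], pointwise arithmetic on [f] becomes
    matrix arithmetic, so operator identities and inequalities reduce to scalar ones for each
    eigenvalue. *)
Definition spec n (V : 'M[C]_n) (f : 'I_n -> R) : 'M[C]_n :=
  adjm V *m diag_mx (\row_i (f i)%:C) *m V.

Lemma unitary1 n : unitary (1%:M : 'M[C]_n).
Proof. by split; rewrite adjm1 mulmx1. Qed.

Lemma spec_id n (f : 'I_n -> R) : spec 1%:M f = diag_mx (\row_i (f i)%:C).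
Proof. by rewrite /spec adjm1 mul1mx mulmx1. Qed.

Lemma spectral_theorem n (A : 'M[C]_n) : adjm A = A ->
  exists V f, unitary V /\ A = spec V f.
Proof.
move=> hA.
have adjE p q (M : 'M[C]_(p, q)) : adjm M = (M ^t* )%sesqui.
  by apply/matrixP => i j; rewrite !mxE.
have herm : A \is hermsymmx.
  by apply/is_hermitianmxP; rewrite expr0 scale1r -adjE hA.
have /orthomx_spectralP := hermitian_normalmx herm.
have /mxOverP re := hermitian_spectral_diag_real herm.
have uU := spectral_unitarymx A.
move: uU re; set V := spectralmx A; set s := spectral_diag A => uU re.
rewrite invmx_unitary // -adjE => eA.
have VV : V *m adjm V = 1%:M by move/unitarymxP: uU; rewrite -adjE.
exists V, (fun i => Rpart (s 0 i)); split.
  by split=> //; apply: mulmx1C.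
rewrite /spec eA; congr (_ *m diag_mx _ *m _).
by apply/rowP => i; rewrite !mxE RRe_real.
Qed.

Lemma diag_mxM n (a b : 'rV[C]_n) : diag_mx a *m diag_mx b = diag_mx (\row_i (a 0 i * b 0 i)).
Proof.
apply/matrixP => i j; rewrite mul_diag_mx !mxE.
by case: eqP => [->|_]; rewrite ?mulr1n ?mulr0n ?mulr0.
Qed.

Section Spec.
Variables (n : nat) (V : 'M[C]_n).
Hypothesis uV : unitary V.

Lemma specM f g : spec V f *m spec V g = spec V (fun i => f i * g i).
Proof.
rewrite /spec -!mulmxA [V *m _]mulmxA uV.2 mul1mx !mulmxA.
rewrite -[_ *m diag_mx _ *m diag_mx _]mulmxA diag_mxM.
by congr (_ *m diag_mx _ *m _); apply/rowP => i; rewrite !mxE rmorphM.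
Qed.
Lemma spec_adjm f : adjm (spec V f) = spec V f.
Proof.
rewrite /spec !adjmM adjmK mulmxA; congr (_ *m _ *m _).
apply/matrixP => i j; rewrite !mxE eq_sym.
by case: eqP => [->|_]; rewrite ?mulr1n ?mulr0n ?conjc_real ?conjc0.
Qed.
Lemma eq_spec f g : f =1 g -> spec V f = spec V g.
Proof. by move=> e; congr (_ *m diag_mx _ *m _); apply/rowP => i; rewrite !mxE e. Qed.
Lemma specD f g : spec V f + spec V g = spec V (fun i => f i + g i).
Proof.
rewrite /spec -mulmxDl -mulmxDr -raddfD /=.
by congr (_ *m diag_mx _ *m _); apply/rowP => i; rewrite !mxE rmorphD.
Qed.
Lemma specZ a f : a%:C *: spec V f = spec V (fun i => a * f i).
Proof.
rewrite /spec scalemxAl scalemxAr -linearZ /=.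
by congr (_ *m diag_mx _ *m _); apply/rowP => i; rewrite !mxE rmorphM.
Qed.
Lemma specN f : - spec V f = spec V (fun i => - f i).
Proof.
rewrite -scaleN1r -(rmorphN1 (real_complex R)) specZ.
by apply: eq_spec => i; rewrite mulN1r.
Qed.
Lemma spec1 : spec V (fun=> 1) = 1%:M.
Proof.
rewrite /spec (_ : diag_mx _ = 1%:M) ?mulmx1 ?uV.1 //.
by apply/matrixP => i j; rewrite !mxE.
Qed.
Lemma spec_psd f : (forall i, 0 <= f i) -> psd (spec V f).
Proof.
move=> f0; rewrite (@eq_spec _ (fun i => Num.sqrt (f i) * Num.sqrt (f i))).
  by rewrite -specM -{2}(spec_adjm (fun i => Num.sqrt (f i))); apply: psd_gram.
by move=> i; rewrite -expr2 sqr_sqrtr.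
Qed.
Lemma trR_spec f (B : 'M[C]_n) :
  trR (spec V f *m B) = \sum_i f i * Rpart ((V *m B *m adjm V) i i).
Proof.
rewrite /spec -mulmxA trRC !mulmxA trRC !mulmxA trRE; apply: eq_bigr => i _.
by rewrite -mulmxA -mulmxA mul_diag_mx mxE mxE mulmxA ReZ.
Qed.
Lemma trR_spec1 f : trR (spec V f) = \sum_i f i.
Proof.
rewrite -[spec V f]mulmx1 trR_spec; apply: eq_bigr => i _.
by rewrite mulmx1 uV.2 mxE eqxx mulr1.
Qed.
Lemma spec_diag f : V *m spec V f *m adjm V = diag_mx (\row_i (f i)%:C).
Proof. by rewrite /spec !mulmxA uV.2 mul1mx -mulmxA uV.2 mulmx1. Qed.
End Spec.

Lemma quad_row n (V B : 'M[C]_n) i :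
  (V *m B *m adjm V) i i = (row i V *m B *m adjm (row i V)) 0 0.
Proof.
have -> : adjm (row i V) = col i (adjm V) by apply/matrixP => a b; rewrite !mxE.
by rewrite -!row_mul !mxE; apply: eq_bigr => k _; rewrite !mxE.
Qed.

Lemma psd_diag_ge0 n (V B : 'M[C]_n) i : psd B -> 0 <= Rpart ((V *m B *m adjm V) i i).
Proof. by move=> /psdP[_ h]; rewrite quad_row. Qed.

Lemma spectral_psd n (A : 'M[C]_n) : psd A ->
  exists V f, [/\ unitary V, A = spec V f & forall i, 0 <= f i].
Proof.
move=> pA; have [V [f [uV eA]]] := spectral_theorem (psd_herm pA).
exists V, f; split=> // i; have := psd_diag_ge0 V i pA.
by rewrite eA spec_diag // !mxE eqxx mulr1n.
Qed.

Lemma trR_psdM n (A B : 'M[C]_n) : psd A -> psd B -> 0 <= trR (A *m B).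
Proof.
move=> /spectral_psd[V [f [uV -> f0]]] pB; rewrite trR_spec // sumr_ge0 // => i _.
by rewrite mulr_ge0 // psd_diag_ge0.
Qed.

Lemma loew_trR n (A B D : 'M[C]_n) : loew A B -> psd D -> trR (A *m D) <= trR (B *m D).
Proof. by move=> h pD; rewrite -subr_ge0 -trRB -mulmxBl trR_psdM. Qed.

Lemma loew_anti n (A B : 'M[C]_n) : loew A B -> loew B A -> A = B.
Proof.
rewrite /loew => /spectral_psd[V [f [uV e f0]]] /psdP [_ h].
apply/eqP; rewrite eq_sym -subr_eq0 e; apply/eqP.
have f00 i : f i = 0.
  apply/le_anti; rewrite f0 andbT -oppr_ge0.
  have := psd_diag_ge0 V i (proj2 (psdP (A - B)) (conj _ h)).
  rewrite -(opprB B A) e specN //.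
  by rewrite spec_diag // !mxE eqxx mulr1n /= => ->//; rewrite spec_adjm.
rewrite (@eq_spec _ _ _ (fun=> 0 * 1)); last by move=> i; rewrite f00 mul0r.
by rewrite -specZ // rmorph0 scale0r.
Qed.

(* An eigenvector [v] of [B - A] with eigenvalue [s < 0] would give
   [0 <= v (B^2 - A^2) v* = s v (A + B) v*], forcing [v A v* = v B v* = 0]. *)
Lemma sqr_loew n (A B : 'M[C]_n) : psd A -> psd B -> loew (A *m A) (B *m B) -> loew A B.
Proof.
move=> pA pB h.
have hB : adjm (B - A) = B - A by rewrite adjmB !psd_herm.
have [V [f [uV e]]] := spectral_theorem hB; rewrite /loew e; apply: spec_psd => // i.
rewrite leNgt; apply/negP => fi.
have qA := psd_diag_ge0 V i pA; have qB := psd_diag_ge0 V i pB.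
have q : Rpart ((V *m (B - A) *m adjm V) i i) = f i.
  by rewrite e spec_diag // !mxE eqxx mulr1n.
have rV : V *m (B - A) = diag_mx (\row_i (f i)%:C) *m V.
  by rewrite e /spec !mulmxA uV.2 mul1mx.
have cV : (B - A) *m adjm V = adjm V *m diag_mx (\row_i (f i)%:C).
  by rewrite e /spec -!mulmxA uV.2 mulmx1.
have := psd_diag_ge0 V i h.
have -> : B *m B - A *m A = (B - A) *m B + A *m (B - A).
  by rewrite mulmxBl mulmxBr addrA subrK.
rewrite mulmxDr mulmxDl mxE ReD !mulmxA rV -!mulmxA cV.
rewrite mul_diag_mx !mulmxA mul_mx_diag !mxE ReZ mulrC.
move: q; rewrite mulmxBr mulmxBl !mxE ReD ReN.
move: qA qB; rewrite !mxE.
set a := Rpart _; set b := Rpart _ => qA qB q.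
rewrite [X in Rpart X]mulrC ReZ [b * _]mulrC => hh.
have fab : f i * (b + a) <= 0 by apply: mulr_le0_ge0; [exact: ltW|exact: addr_ge0].
have ab0 : a + b = 0.
  apply/eqP; move: hh; rewrite -mulrDr => hh.
  by have/eqP := le_anti (introT andP (conj fab hh)); rewrite mulf_eq0 (lt_eqF fi) /= addrC.
by clearbody a b; move: fi qA qB q ab0; clear => *; lra.
Qed.

Lemma sqrtm_ex n (A : 'M[C]_n) : psd A -> exists X : 'M[C]_n, psd X /\ X *m X = A.
Proof.
move=> /spectral_psd[V [f [uV -> f0]]].
exists (spec V (fun i => Num.sqrt (f i))); split.
  by apply: spec_psd => // i; rewrite sqrtr_ge0.
by rewrite specM //; apply: eq_spec => // i; rewrite -expr2 sqr_sqrtr.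
Qed.

Lemma sqrtmP n (A : 'M[C]_n) : psd A -> psd (sqrtm A) /\ sqrtm A *m sqrtm A = A.
Proof.
move=> pA; have [X hX] := sqrtm_ex pA.
exact: (@xgetPex _ 0 [set X | psd X /\ X *m X = A] (ex_intro _ X hX)).
Qed.
Lemma psd_sqrtm n (A : 'M[C]_n) : psd A -> psd (sqrtm A).
Proof. by case/sqrtmP. Qed.
Lemma sqrtmK n (A : 'M[C]_n) : psd A -> sqrtm A *m sqrtm A = A.
Proof. by case/sqrtmP. Qed.
Lemma sqrtm_herm n (A : 'M[C]_n) : psd A -> adjm (sqrtm A) = sqrtm A.
Proof. by case/sqrtmP => /psd_herm. Qed.

(** [sqrtm] is defined by choice, and this is how its value is computed. Two positive roots have
    equal squares, so by [sqr_loew] each dominates the other. *)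
Lemma sqrtm_uniq n (A X : 'M[C]_n) : psd X -> X *m X = A -> sqrtm A = X.
Proof.
move=> pX e.
have pA : psd A by rewrite -e -{1}(psd_herm pX); apply: psd_gramV.
have [pS eS] := sqrtmP pA.
have le (M N : 'M[C]_n) : psd M -> psd N -> M *m M = N *m N -> loew M N.
  by move=> pM pN eMN; apply: sqr_loew pM pN _; rewrite eMN; apply: loew_refl.
by apply: loew_anti; [apply: le pS pX _|apply: le pX pS _]; rewrite eS e.
Qed.

Lemma sqrtmZ n (a : R) (A : 'M[C]_n) : 0 <= a -> psd A ->
  sqrtm (a%:C *: A) = (Num.sqrt a)%:C *: sqrtm A.
Proof.
move=> a0 pA; apply: sqrtm_uniq; first by apply: psdZ; rewrite ?sqrtr_ge0 //; apply: psd_sqrtm.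
by rewrite -scalemxAl -scalemxAr scalerA -rmorphM -expr2 sqr_sqrtr // sqrtmK.
Qed.

End MatrixAnalysis.

Local Opaque psd spec sqrtm.

(** * Trace norm and fidelity *)

Section TraceNorm.
Variable R : realType.
Local Notation C := R[i].
Local Notation Rpart := (@complex.Re R).

(** Expand the squared Hilbert-Schmidt norm of [r A - adjm B], which is nonnegative. *)
Lemma trR_amgm m n (r : R) (A : 'M[C]_(m, n)) (B : 'M[C]_(n, m)) : 0 < r ->
  trR (A *m B) <= (r * trR (A *m adjm A) + trR (adjm B *m B) / r) / 2.
Proof.
move=> r0; have := hsE (r%:C *: A - adjm B).
rewrite adjmB adjmZ adjmK mulmxBr !mulmxBl !trRB.
rewrite -!scalemxAl -!scalemxAr !trRZ -[adjm B *m adjm A]adjmM trR_adjm.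
set x := trR _; set z := trR _; set y := trR _.
move=> h.
have -> : (r * x + y / r) / 2 = (r * (r * x) + y) / (r * 2).
  by field; rewrite gt_eqF.
rewrite ler_pdivlMr ?mulr_gt0 //; clearbody x y z; clear A B; nra.
Qed.

Lemma trR_CS m n (A : 'M[C]_(m, n)) (B : 'M[C]_(n, m)) :
  trR (A *m B) <= Num.sqrt (trR (A *m adjm A)) * Num.sqrt (trR (adjm B *m B)).
Proof.
have x0 := hsE A; have := hsE (adjm B); rewrite adjmK => y0.
have h r : 0 < r -> _ := @trR_amgm _ _ r A B.
move: h x0 y0; set x := trR (A *m adjm A); set y := trR (adjm B *m B).
set z := trR _ => h x0 y0.
have [z0|z0] := leP z 0; first by rewrite (le_trans z0) // mulr_ge0 ?sqrtr_ge0.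
rewrite -sqrtrM // -(ger0_norm (ltW z0)) -sqrtr_sqr ler_wsqrtr //.
have h' r : 0 < r -> 2 * z <= r * x + y / r by move=> /h; rewrite ler_pdivlMr // mulrC.
move: x0; rewrite le_eqVlt => /orP[/eqP x0|x0].
  (* For [x = 0] this [r] yields [2 z <= y z / (y + 1)], impossible for [z > 0]. *)
  have r0 : 0 < (y + 1) / z by rewrite divr_gt0 // ltr_wpDl.
  have := h' _ r0; rewrite -x0 mulr0 add0r invf_div mulrA ler_pdivlMr ?ltr_wpDl //.
  by clearbody x y z; clear -z0 y0; nra.
(* This [r] balances the two terms when Cauchy-Schwarz is an equality. *)
have := h' (z / x) (divr_gt0 z0 x0); rewrite divfK ?gt_eqF // invf_div => h2.
have : z <= y * (x / z) by lra.
by rewrite mulrA ler_pdivlMr // [y * x]mulrC expr2.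
Qed.

Definition contraction n (K : 'M[C]_n) := loew (K *m adjm K) 1%:M.
Definition effect n (L : 'M[C]_n) := psd L /\ loew L 1%:M.

Lemma spec_loew1 n (V : 'M[C]_n) f : unitary V -> (forall i, f i <= 1) ->
  loew (spec V f) 1%:M.
Proof.
move=> uV f1; rewrite /loew -(spec1 uV) specN specD; apply: (spec_psd uV) => i.
by rewrite subr_ge0.
Qed.

Lemma spec_loewP n (V : 'M[C]_n) f g i : unitary V ->
  loew (spec V f) (spec V g) -> f i <= g i.
Proof.
move=> uV h; have := psd_diag_ge0 V i h.
by rewrite specN specD (spec_diag uV) !mxE eqxx mulr1n subr_ge0.
Qed.

Lemma loew_diag_mx n (f : 'I_n -> R) (l : R) : (forall i, f i <= l) ->
  loew (diag_mx (\row_i (f i)%:C)) (l%:C *: 1%:M).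
Proof.
move=> fl; have u1 := unitary1 R n.
rewrite /loew -(spec1 u1) specZ -spec_id specN specD; apply: (spec_psd u1) => i.
by rewrite mulr1 subr_ge0.
Qed.

Lemma effect_sqr n (L : 'M[C]_n) : effect L -> loew (L *m L) L.
Proof.
case=> /spectral_psd[V [f [uV -> f0]]].
rewrite -(spec1 uV) => h; rewrite (specM uV) /loew specN specD.
apply: (spec_psd uV) => i; have := spec_loewP i uV h; have := f0 i; clear; move: (f i).
by move=> x; nra.
Qed.

Lemma psd_sqr_le n (M : 'M[C]_n) : psd M -> loew (M *m M) M -> loew M 1%:M.
Proof.
move=> /spectral_psd[V [f [uV -> f0]]]; rewrite (specM uV) => h.
apply: (spec_loew1 uV) => i; have := spec_loewP i uV h; have := f0 i; clear; move: (f i).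
by move=> x; nra.
Qed.

Lemma contraction_adjm n (K : 'M[C]_n) : contraction K -> contraction (adjm K).
Proof.
move=> h; rewrite /contraction adjmK; apply: psd_sqr_le; first exact: psd_gramV.
have := psd_conj (adjm K) h; rewrite mulmxBr mulmxBl mulmx1 adjmK.
by rewrite /loew !mulmxA.
Qed.

(** With [P = sqrt (A* A)], the maximiser is [P^-1 A*], the inverse being taken on the support of
    [P]: the convention [0^-1 = 0] makes [K K*] a projector and [K A = P], even for singular [A]. *)
Lemma tnorm_attain n (A : 'M[C]_n) :
  exists K, contraction K /\ trR (K *m A) = tnorm A.
Proof.
have [pS eS] := sqrtmP (psd_gramV A).
rewrite /tnorm; move: pS eS; set P := sqrtm _ => pS.
have [V [s [uV eP s0]]] := spectral_psd pS; rewrite eP (specM uV) => e.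
exists (spec V (fun i => (s i)^-1) *m adjm A); split.
  rewrite /contraction adjmM adjmK spec_adjm -mulmxA [adjm A *m _]mulmxA -e !(specM uV).
  apply: (spec_loew1 uV) => i.
  have [->|si] := eqVneq (s i) 0; first by rewrite !mulr0 mul0r mulr0.
  by rewrite -mulrA divff // mulr1 mulVf.
rewrite -mulmxA -e (specM uV) (@eq_spec _ _ _ _ s) => [|i]; first by [].
have [->|si] := eqVneq (s i) 0; first by rewrite !mulr0.
by rewrite mulKf.
Qed.

(** Take the trace in the eigenbasis of [sqrt (A* A)]. Cauchy-Schwarz bounds each term by the
    product of the norms of [v_i K], at most 1, and of [A v_i*], which is the singular value
    [s i]. *)
Lemma tnorm_ub n (K A : 'M[C]_n) : contraction K -> trR (K *m A) <= tnorm A.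
Proof.
move=> cK; have [pS eS] := sqrtmP (psd_gramV A).
rewrite /tnorm; move: pS eS; set P := sqrtm _ => pS.
have [V [s [uV eP s0]]] := spectral_psd pS; rewrite eP (specM uV) (trR_spec1 uV) => e.
rewrite -[K *m A]mul1mx -(spec1 uV) trR_spec; apply: ler_sum => i _; rewrite mul1r.
have -> : Rpart ((V *m (K *m A) *m adjm V) i i)
  = trR ((row i V *m K) *m (A *m adjm (row i V))).
  by rewrite quad_row trRE big_ord1 !mulmxA.
apply: le_trans (trR_CS _ _) _.
rewrite -[X in _ <= X]mul1r; apply: ler_pM; rewrite ?sqrtr_ge0 //.
  rewrite -[X in _ <= X]sqrtr1 ler_wsqrtr //.
  rewrite adjmM mulmxA -[row i V *m K *m _]mulmxA trRE big_ord1 -quad_row.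
  have := psd_diag_ge0 V i cK; rewrite mulmxBr mulmxBl mulmx1 uV.2 !mxE eqxx ReD ReN.
  by rewrite subr_ge0.
rewrite adjmM adjmK mulmxA -[_ *m adjm A *m A]mulmxA -e trRE big_ord1 -quad_row.
by rewrite (spec_diag uV) !mxE eqxx mulr1n /= -expr2 sqrtr_sqr ger0_norm.
Qed.

Lemma contraction1 n : contraction (1%:M : 'M[C]_n).
Proof. by rewrite /contraction adjm1 mulmx1; apply: loew_refl. Qed.

Lemma contractionN n (K : 'M[C]_n) : contraction K -> contraction (- K).
Proof. by rewrite /contraction adjmN mulmxN mulNmx opprK. Qed.

Lemma le_trR_tnorm n (A : 'M[C]_n) : trR A <= tnorm A.
Proof. by have := tnorm_ub A (contraction1 n); rewrite mul1mx. Qed.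

Lemma tnormD n (A B : 'M[C]_n) : tnorm (A + B) <= tnorm A + tnorm B.
Proof.
have [K [cK <-]] := tnorm_attain (A + B); rewrite mulmxDr trRD.
by apply: lerD; apply: tnorm_ub.
Qed.

Lemma tnormN n (A : 'M[C]_n) : tnorm (- A) = tnorm A.
Proof.
suff le (B : 'M[C]_n) : tnorm (- B) <= tnorm B.
  by apply/le_anti; rewrite le /= -{1}[A]opprK le.
have [K [cK <-]] := tnorm_attain (- B); rewrite mulmxN -mulNmx.
by apply: tnorm_ub; apply: contractionN.
Qed.

Lemma tnormB n (A B : 'M[C]_n) : tnorm (A - B) = tnorm (B - A).
Proof. by rewrite -tnormN opprB. Qed.

Lemma norm_trR_tnorm n (A : 'M[C]_n) : `|trR A| <= tnorm A.
Proof.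
rewrite ler_norml le_trR_tnorm andbT lerNl -trRN -[leRHS]tnormN.
exact: le_trR_tnorm.
Qed.

Lemma tnorm_ge0 n (A : 'M[C]_n) : 0 <= tnorm A.
Proof. by apply: le_trans (norm_trR_tnorm A). Qed.

Lemma tnorm0 n : tnorm (0 : 'M[C]_n) = 0.
Proof. by have [K [_ <-]] := tnorm_attain (0 : 'M[C]_n); rewrite mulmx0 trR0. Qed.

Lemma tnormZ n (a : R) (A : 'M[C]_n) : 0 <= a -> tnorm (a%:C *: A) = a * tnorm A.
Proof.
move=> a0; apply/le_anti/andP; split.
  have [K [cK <-]] := tnorm_attain (a%:C *: A).
  by rewrite -scalemxAr trRZ ler_wpM2l // tnorm_ub.
have [K [cK <-]] := tnorm_attain A.
by rewrite -trRZ scalemxAr tnorm_ub.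
Qed.

Lemma tnorm_sum n (I : Type) (r : seq I) (P : pred I) (F : I -> 'M[C]_n) :
  tnorm (\sum_(i <- r | P i) F i) <= \sum_(i <- r | P i) tnorm (F i).
Proof.
apply: (big_ind2 (fun x y => tnorm x <= y)) => //; first by rewrite tnorm0.
by move=> A a B b hA hB; apply: le_trans (tnormD A B) (lerD hA hB).
Qed.

Lemma tnorm_adjm n (A : 'M[C]_n) : tnorm (adjm A) = tnorm A.
Proof.
suff le (B : 'M[C]_n) : tnorm (adjm B) <= tnorm B.
  by apply/le_anti; rewrite le /= -{1}[A]adjmK le.
have [K [cK <-]] := tnorm_attain (adjm B).
rewrite -[K]adjmK -adjmM trR_adjm trRC; apply: tnorm_ub.
exact: contraction_adjm.
Qed.

(** The optimal contraction [K] is absorbed into [A]: since [K* K <= 1], [K A] has no larger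
    Hilbert-Schmidt norm. *)
Lemma tnorm_holder m n (A : 'M[C]_(n, m)) (B : 'M[C]_(m, n)) :
  tnorm (A *m B) <= Num.sqrt (trR (A *m adjm A)) * Num.sqrt (trR (adjm B *m B)).
Proof.
have [K [cK <-]] := tnorm_attain (A *m B); rewrite mulmxA.
apply: le_trans (trR_CS _ _) _; apply: ler_wpM2r; rewrite ?sqrtr_ge0 // ler_wsqrtr //.
rewrite adjmM mulmxA trRC !mulmxA -mulmxA -[leRHS]mul1r -[1]/(1%R : R).
have := loew_trR (contraction_adjm cK) (psd_gram A).
by rewrite adjmK mul1mx mul1r.
Qed.

(** [L] projects onto the nonnegative eigenspaces: on eigenvalues, [|a|] is [2 a - a] or [0 - a]. *)
Lemma herm_tnorm n (A : 'M[C]_n) : adjm A = A ->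
  exists L, effect L /\ tnorm A = 2 * trR (L *m A) - trR A.
Proof.
move=> hA; have [V [a [uV eA]]] := spectral_theorem hA.
exists (spec V (fun i => ((0 <= a i)%R)%:R)); split.
  split; first by apply: (spec_psd uV) => i; rewrite ler0n.
  by apply: (spec_loew1 uV) => i; rewrite lern1 leq_b1.
rewrite /tnorm (@sqrtm_uniq _ _ _ (spec V (fun i => `|a i|))).
  rewrite eA (specM uV) !(trR_spec1 uV) mulr_sumr -sumrB; apply: eq_bigr => i _.
  by case: leP => h; rewrite ?(ger0_norm h) ?(ltr0_norm h) ?mul1r ?mul0r ?mulr0; ring.
  exact: (spec_psd uV).
rewrite hA eA !(specM uV); apply: eq_spec => i.
by rewrite -!expr2 real_normK // num_real.
Qed.

(** [2 L - 1] is a contraction, because [1 - (2 L - 1)^2 = 4 (L - L^2)]. *)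
Lemma effect_tnorm n (L A : 'M[C]_n) : effect L -> 2 * trR (L *m A) - trR A <= tnorm A.
Proof.
move=> eL; have -> : 2 * trR (L *m A) - trR A = trR ((L + L - 1%:M) *m A).
  by rewrite mulmxBl mulmxDl mul1mx trRB trRD; ring.
apply: tnorm_ub; rewrite /contraction /loew.
have hL := psd_herm eL.1.
have := psdZ (ler0n R 4) (effect_sqr eL); rewrite scalerBr.
rewrite adjmB adjmD adjm1 hL mulmxBl mulmxBr !mulmxDl !mulmxDr !mul1mx !mulmx1.
congr psd; move: (L *m L) => M; apply/matrixP => i j; rewrite !mxE.
by rewrite (rmorph_nat (real_complex R)); ring.
Qed.

Lemma effectC n (L : 'M[C]_n) : effect L -> effect (1%:M - L).
Proof. by case=> h1 h2; split; [exact: h2|rewrite /loew subKr; exact: h1]. Qed.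

Lemma effect_trR n (L A : 'M[C]_n) : effect L -> psd A -> 0 <= trR (L *m A) <= trR A.
Proof.
move=> [h1 h2] pA; rewrite trR_psdM //=.
by have := loew_trR h2 pA; rewrite mul1mx.
Qed.

Section TraceIdentities.
Variables (A : pzRingType) (f : A -> R).
Hypothesis fD : forall a b, f (a + b) = f a + f b.
Hypothesis fN : forall a, f (- a) = - f a.

(** Commutation of [L] with [S - T] and cyclicity of [f] give [f (L S T) = f (L T S)], so the cross
    terms cancel. *)
Lemma trace_polarize (L S T : A) : (forall a b, f (a * b) = f (b * a)) ->
  L * (S - T) = (S - T) * L ->
  f (L * (S * S)) - f (L * (T * T)) = f (L * (S - T) * (S + T)).
Proof.
move=> fC c.
have : f (L * (S - T) * S) = f ((S - T) * L * S) by rewrite c.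
have := fC T (L * S); have := fC S (L * S).
rewrite !(mulrDr, mulrDl, mulrN, mulNr) !(fD, fN) !mulrA.
by lra.
Qed.

(** Read [L + T] as an operator [H], [X] as its inverse root and [Y] as its root. In an abstract
    ring with an additive [f], expansion leaves values of [f] at monomials, and the inequality is
    linear in them. *)
Lemma hayashi_nagaoka_trace (X Y L T t : A) :
  0 <= f ((1 + 1 - X) * T * (1 + 1 - X) * t) ->
  0 <= f ((X - 1) * L * (X - 1) * t) ->
  f ((L + T) * X * t) = f (Y * t) ->
  f (X * (L + T) * t) = f (Y * t) ->
  f (X * (L + T) * X * t) = f t ->
  0 <= f ((Y - L) * t) ->
  f t - f (X * L * X * t) <= 2 * (f t - f (L * t)) + 4 * f (T * t).
Proof.
rewrite !(mulrDr, mulrDl, mulrN, mulNr, mulr1, mul1r, opprK, opprD) !(fD, fN).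
by lra.
Qed.
End TraceIdentities.

(* With [D = sqrt r - sqrt t] and [L] the projector on the nonnegative part of [D]:
   [tr r - tr (sqrt r sqrt t) = tr (sqrt r D)] and [tr L (r - t) = tr D_+ (sqrt r + sqrt t)],
   which compare term by term in the eigenbasis of [D]. *)
Lemma powers_stormer n (r t : 'M[C]_n) : psd r -> psd t ->
  exists L, effect L /\ trR r - trR (L *m r) + trR (L *m t) <= trR (sqrtm r *m sqrtm t).
Proof.
move=> pr pt; have [pS eS] := sqrtmP pr; have [pT eT] := sqrtmP pt.
move: pS eS pT eT; set S := sqrtm r; set T := sqrtm t => pS eS pT eT.
clearbody S T.
have hD : adjm (S - T) = S - T by rewrite adjmB !psd_herm.
have [V [d [uV eD]]] := spectral_theorem hD.
pose L := spec V (fun i => ((0 <= d i)%R)%:R).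
have eL : effect L.
  split; first by apply: (spec_psd uV) => i; rewrite ler0n.
  by apply: (spec_loew1 uV) => i; rewrite lern1 leq_b1.
have c : L *m (S - T) = (S - T) *m L.
  by rewrite eD !(specM uV); apply: eq_spec => i; rewrite mulrC.
have LD : L *m (S - T) = spec V (fun i => ((0 <= d i)%R)%:R * d i) by rewrite eD (specM uV).
clearbody L; exists L; split; first exact: eL.
have e1 : trR r - trR (S *m T) = trR ((S - T) *m S).
  by rewrite mulmxBl trRB eS [trR (T *m S)]trRC.
have e2 : trR (L *m r) - trR (L *m t) = trR ((L *m (S - T)) *m (S + T)).
  by rewrite -eS -eT; apply: (trace_polarize (@trRD R n) (@trRN R n) (@trRC R n n) c).
suff : trR r - trR (S *m T) <= trR (L *m r) - trR (L *m t) by lra.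
rewrite e1 e2 LD eD !trR_spec; apply: ler_sum => i _.
have := psd_diag_ge0 V i pS; have := psd_diag_ge0 V i pT.
rewrite mulmxDr mulmxDl [X in _ -> _ -> _ <= _ * Rpart X]mxE ReD.
move: (Rpart _) (Rpart _) (d i) => x y z; clear => x0 y0.
by case: (leP 0 z) => z0; rewrite ?mul1r ?mul0r; nra.
Qed.

(** * Fidelity and purified distance under measurement *)

Section Fidelity.
Variable n : nat.
Implicit Types r t L : 'M[C]_n.

Lemma trR_sqrtm_le_fid r t : trR (sqrtm r *m sqrtm t) <= fid r t.
Proof. exact: le_trR_tnorm. Qed.

Lemma fid_ge0 r t : 0 <= fid r t.
Proof. exact: tnorm_ge0. Qed.

Lemma fid_sym r t : psd r -> psd t -> fid r t = fid t r.
Proof. by move=> pr pt; rewrite /fid -tnorm_adjm adjmM !sqrtm_herm. Qed.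

Lemma fidE r t : psd r -> psd t -> fid r t = trR (sqrtm (sqrtm t *m r *m sqrtm t)).
Proof.
move=> pr pt; rewrite /fid /tnorm adjmM !sqrtm_herm //.
by rewrite mulmxA -[sqrtm t *m sqrtm _ *m sqrtm _]mulmxA sqrtmK.
Qed.

(** A two-outcome measurement does not decrease fidelity: split [1 = L + (1 - L)] and apply Hoelder
    to [(sqrt r sqrt M) (sqrt M sqrt t)] for each outcome [M]. *)
Lemma fid_meas r t L : psd r -> psd t -> effect L ->
  fid r t <= Num.sqrt (trR (L *m r)) * Num.sqrt (trR (L *m t))
           + Num.sqrt (trR ((1%:M - L) *m r)) * Num.sqrt (trR ((1%:M - L) *m t)).
Proof.
move=> pr pt eL.
have -> : fid r t = tnorm (sqrtm r *m L *m sqrtm t + sqrtm r *m (1%:M - L) *m sqrtm t).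
  by rewrite -mulmxDl -mulmxDr addrC subrK mulmx1.
have half (M : 'M[C]_n) : psd M -> tnorm (sqrtm r *m M *m sqrtm t)
   <= Num.sqrt (trR (M *m r)) * Num.sqrt (trR (M *m t)).
  move=> pM; rewrite -{1}(sqrtmK pM) mulmxA -mulmxA.
  apply: le_trans (tnorm_holder _ _) _.
  rewrite !adjmM !sqrtm_herm // !mulmxA.
  rewrite -[sqrtm r *m sqrtm M *m sqrtm M]mulmxA -[sqrtm t *m sqrtm M *m sqrtm M]mulmxA.
  rewrite !sqrtmK // trRC mulmxA sqrtmK // [trR (r *m M)]trRC.
  by rewrite [X in _ * Num.sqrt X <= _]trRC mulmxA sqrtmK // [trR (t *m M)]trRC.
apply: le_trans (tnormD _ _) _; apply: lerD; apply: half; first exact: eL.1.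
by case: (effectC eL).
Qed.

Lemma qstate_trR r : qstate r -> trR r = 1.
Proof. by rewrite /trR => -[_ ->]. Qed.

Lemma pdist_meas r t L (a : R) : qstate r -> subnormalized t -> pdist r t <= a ->
  effect L -> `|trR (L *m r) - trR (L *m t)| <= a.
Proof.
move=> qr [pt tt] h eL; have pr := qr.1; have tr := qstate_trR qr.
apply: le_trans h; rewrite /pdist -sqrtr_sqr ler_wsqrtr // .
have := fid_meas pr pt eL; have := fid_ge0 r t.
have /andP[] := effect_trR eL pr; have /andP[] := effect_trR eL pt.
rewrite !mulmxBl !mul1mx !trRB tr.
move: (trR (L *m r)) (trR (L *m t)) (trR t) (fid r t) tt => p q s F; clear => s1 q0 qs p0 p1 F0.
set a := Num.sqrt p; set b := Num.sqrt q.
set a' := Num.sqrt (1 - p); set b' := Num.sqrt (1 - q).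
have ha : a ^+ 2 = p by rewrite sqr_sqrtr.
have hb : b ^+ 2 = q by rewrite sqr_sqrtr.
have ha' : a' ^+ 2 = 1 - p by rewrite sqr_sqrtr ?subr_ge0.
have hb' : b' ^+ 2 = 1 - q by rewrite sqr_sqrtr ?subr_ge0 // (le_trans qs).
have [a0 b0 a'0 b'0] : [/\ 0 <= a, 0 <= b, 0 <= a' & 0 <= b'] by rewrite !sqrtr_ge0.
(* The mass missing from the subnormalized [t] is added to the second outcome, so that [(a, a')] and
   [(b, b')] are both unit vectors. *)
move=> F1; have {F1} : F <= a * b + a' * b'.
  apply: le_trans F1 _; rewrite lerD2l ler_wpM2l // ler_wsqrtr //; lra.
move=> F1; have F2 : F ^+ 2 <= (a * b + a' * b') ^+ 2.
  by rewrite ler_pXn2r // nnegrE ?addr_ge0 ?mulr_ge0.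
clearbody a b a' b'.
(* For unit vectors at angles [u] and [v] this is [1 - cos^2 (u - v) = sin^2 (u - v)], and below,
   [p - q] is up to sign [sin (u - v) sin (u + v)]. *)
have e1 : 1 - (a * b + a' * b') ^+ 2 = (a * b' - a' * b) ^+ 2.
  have : (a ^+ 2 + a' ^+ 2) * (b ^+ 2 + b' ^+ 2) = 1 by rewrite ha hb ha' hb'; ring.
  by move=> <-; ring.
have e2 : p - q = (a * b' - a' * b) * (a * b' + a' * b).
  have -> : (a * b' - a' * b) * (a * b' + a' * b) = a ^+ 2 * b' ^+ 2 - a' ^+ 2 * b ^+ 2.
    by ring.
  by rewrite ha hb ha' hb'; ring.
have e3 : (a * b' + a' * b) ^+ 2 <= 1.
  have : (a ^+ 2 + a' ^+ 2) * (b ^+ 2 + b' ^+ 2) = 1 by rewrite ha hb ha' hb'; ring.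
  have := sqr_ge0 (a * b - a' * b'); clear; nra.
rewrite e2 exprMn; have := sqr_ge0 (a * b' - a' * b).
move: e1 e3 F2; move: (_ ^+ 2) (_ ^+ 2) (_ ^+ 2) (_ ^+ 2) => *; nra.
Qed.

Lemma tnorm_sqrtm r t : qstate r -> qstate t ->
  1 - tnorm (r - t) / 2 <= trR (sqrtm r *m sqrtm t).
Proof.
move=> qr qt; have [L [eL h]] := powers_stormer qr.1 qt.1.
have := effect_tnorm (r - t) eL; rewrite mulmxBr !trRB.
move: h; rewrite (qstate_trR qr) (qstate_trR qt).
move: (trR _) (trR _) (trR _) (tnorm _) => *; lra.
Qed.

(* [2 (1 - L) + 4 (G - L) - (1 - X L X)] is a sum of the positive terms
   [(2 - X) (G - L) (2 - X)], [2 (X - 1) L (X - 1)] and [4 (sqrt G - L)]. *)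
Lemma hayashi_nagaoka (G : 'M[C]_n) (eta : R) : psd G -> 0 < eta ->
  exists X, [/\ psd X, X *m (G + eta%:C%:M) *m X = 1%:M &
    forall L t, effect L -> loew L (G + eta%:C%:M) -> psd t ->
      trR t - trR (X *m L *m X *m t)
      <= 2 * (trR t - trR (L *m t)) + 4 * trR ((G + eta%:C%:M - L) *m t)].
Proof.
move=> pG e0; have [V [g [uV eG g0]]] := spectral_psd pG.
pose f i := g i + eta.
have f0 i : 0 < f i by rewrite ltr_wpDl.
have sf0 i : Num.sqrt (f i) != 0 by rewrite gt_eqF // sqrtr_gt0.
have -> : G + eta%:C%:M = spec V f.
  by rewrite -scalemx1 -(spec1 uV) specZ eG specD; apply: eq_spec => i; rewrite mulr1.
have [H eH] : exists H, H = spec V f by exists (spec V f).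
rewrite -eH.
pose X := spec V (fun i => (Num.sqrt (f i))^-1).
pose Y := spec V (fun i => Num.sqrt (f i)).
have pX : psd X by apply: (spec_psd uV) => i; rewrite invr_ge0 sqrtr_ge0.
have pY : psd Y by apply: (spec_psd uV) => i; rewrite sqrtr_ge0.
have YY : Y *m Y = H.
  by rewrite eH (specM uV); apply: eq_spec => i; rewrite -expr2 sqr_sqrtr // ltW.
have XY : X *m Y = 1%:M by rewrite (specM uV) -(spec1 uV); apply: eq_spec => i; rewrite mulVf.
have YX : Y *m X = 1%:M by rewrite (specM uV) -(spec1 uV); apply: eq_spec => i; rewrite divff.
have XHX : X *m H *m X = 1%:M by rewrite -YY mulmxA XY mul1mx YX.
exists X; split=> // L t eL LH pt.
have hX := psd_herm pX.
pose T := H - L; have eHT : H = L + T by rewrite addrC subrK.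
have h1 := trR_psdM (psd_conj (1%:M + 1%:M - X) LH) pt.
have h2 := trR_psdM (psd_conj (X - 1%:M) eL.1) pt.
(* [L^2 <= L <= H = Y^2], and the square root is operator monotone. *)
have LY : loew L Y.
  by apply: sqr_loew eL.1 pY _; rewrite YY; apply: loew_trans LH; apply: effect_sqr.
have := trR_psdM LY pt.
have : trR (X *m H *m X *m t) = trR t by rewrite XHX mul1mx.
have : trR (X *m H *m t) = trR (Y *m t) by rewrite -YY mulmxA XY mul1mx.
have : trR (H *m X *m t) = trR (Y *m t) by rewrite -YY -[Y *m Y *m X]mulmxA YX mulmx1.
rewrite adjmB adjmD adjm1 hX -/T in h1; rewrite adjmB adjm1 hX in h2.
rewrite -/T eHT => h3 h4 h5 h6.
exact: (hayashi_nagaoka_trace (@trRD R n) (@trRN R n) h1 h2 h3 h4 h5 h6).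
Qed.
End Fidelity.
End TraceNorm.

(** * Block-diagonal matrices and partial traces *)

Section Blocks.
Variable R : realType.
Local Notation C := R[i].
Local Notation Rpart := (@complex.Re R).
Local Notation idx := mxtens_index.

Lemma psd_mxsub m n (f : 'I_m -> 'I_n) (A : 'M[C]_n) : psd A -> psd (mxsub f f A).
Proof.
move=> pA; pose E : 'M[C]_(m, n) := \matrix_(i, r) (r == f i)%:R.
suff -> : mxsub f f A = E *m A *m adjm E by apply: psd_conj.
apply/matrixP => i j; rewrite !mxE (bigD1 (f j)) //= big1 => [|r rj].
  rewrite !mxE eqxx conjc1 mulr1 addr0 (bigD1 (f i)) //= big1 => [|r ri].
    by rewrite !mxE eqxx mul1r addr0.
  by rewrite !mxE (negPf ri) mul0r.
by rewrite !mxE (negPf rj) conjc0 mulr0.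
Qed.

Lemma big_tens n d (V : nmodType) (f : 'I_(n * d) -> V) :
  \sum_r f r = \sum_i \sum_k f (idx (i, k)).
Proof.
rewrite pair_bigA /=; apply: reindex => /=.
exists (@mxtens_unindex n d) => x _; first by rewrite -surjective_pairing mxtens_indexK.
by rewrite -surjective_pairing mxtens_unindexK.
Qed.

Lemma tens_matrixP n d (A B : 'M[C]_(n * d)) :
  (forall i j k l, A (idx (i, k)) (idx (j, l)) = B (idx (i, k)) (idx (j, l))) -> A = B.
Proof.
move=> h; apply/matrixP => r s.
by case: (mxtens_indexP r) => i k; case: (mxtens_indexP s) => j l.
Qed.

(** The form of classical-quantum operators, with [i] the classical letter: products, roots and
    traces are computed block by block. *)
Definition bdiag n d (F : 'I_n -> 'M[C]_d) : 'M[C]_(n * d) :=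
  \matrix_(r, s) if (mxtens_unindex r).1 == (mxtens_unindex s).1
    then F (mxtens_unindex r).1 (mxtens_unindex r).2 (mxtens_unindex s).2 else 0.

Definition bget n d (i : 'I_n) (A : 'M[C]_(n * d)) : 'M[C]_d :=
  mxsub (fun k => idx (i, k)) (fun k => idx (i, k)) A.

Section Ops.
Variables n d : nat.
Implicit Types (F G : 'I_n -> 'M[C]_d) (A B : 'M[C]_(n * d)).

Lemma bdiagE F i j k l :
  bdiag F (idx (i, k)) (idx (j, l)) = if i == j then F i k l else 0.
Proof. by rewrite mxE !mxtens_indexK. Qed.

Lemma eq_bdiag F G : F =1 G -> bdiag F = bdiag G.
Proof. by move=> e; apply: tens_matrixP => *; rewrite !bdiagE e. Qed.

Lemma bdiag_bget A i k l : bget i A k l = A (idx (i, k)) (idx (i, l)).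
Proof. by rewrite mxE. Qed.

Lemma bget_bdiag F i : bget i (bdiag F) = F i.
Proof. by apply/matrixP => k l; rewrite bdiag_bget bdiagE eqxx. Qed.

Lemma bdiagM F G : bdiag F *m bdiag G = bdiag (fun i => F i *m G i).
Proof.
apply: tens_matrixP => i j k l; rewrite bdiagE mxE big_tens (bigD1 i) //= [X in _ + X]big1 => [|i' ne].
  rewrite addr0; case: eqP => [<-|/eqP ne].
    by rewrite mxE; apply: eq_bigr => m _; rewrite !bdiagE !eqxx.
  by rewrite big1 // => m _; rewrite !bdiagE (negPf ne) mulr0.
by rewrite big1 // => m _; rewrite !bdiagE eq_sym (negPf ne) mul0r.
Qed.

Lemma bdiag_adjm F : adjm (bdiag F) = bdiag (fun i => adjm (F i)).
Proof.
apply: tens_matrixP => i j k l; rewrite mxE !bdiagE eq_sym.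
by case: eqP => [->|_]; rewrite ?mxE ?conjc0.
Qed.

Lemma trR_bdiagM F A : trR (bdiag F *m A) = \sum_i trR (F i *m bget i A).
Proof.
rewrite trRE big_tens; apply: eq_bigr => i _; rewrite trRE; apply: eq_bigr => k _.
rewrite !mxE big_tens (bigD1 i) //= [X in _ + X]big1 => [|i' ne]; last first.
  by rewrite big1 // => l _; rewrite bdiagE eq_sym (negPf ne) mul0r.
by rewrite addr0; congr Rpart; apply: eq_bigr => l _; rewrite bdiagE eqxx bdiag_bget.
Qed.

Lemma trR_bdiag F : trR (bdiag F) = \sum_i trR (F i).
Proof.
rewrite trRE big_tens; apply: eq_bigr => i _; rewrite trRE; apply: eq_bigr => k _.
by rewrite bdiagE eqxx.
Qed.

Lemma psd_bdiag F : (forall i, psd (F i)) -> psd (bdiag F).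
Proof.
move=> pF; have -> : bdiag F = bdiag (fun i => sqrtm (F i)) *m adjm (bdiag (fun i => sqrtm (F i))).
  by rewrite bdiag_adjm bdiagM; apply: eq_bdiag => i; rewrite sqrtm_herm ?sqrtmK.
exact: psd_gram.
Qed.

Lemma sqrtm_bdiag F : (forall i, psd (F i)) -> sqrtm (bdiag F) = bdiag (fun i => sqrtm (F i)).
Proof.
move=> pF; apply: sqrtm_uniq; first by apply: psd_bdiag => i; apply: psd_sqrtm.
by rewrite bdiagM; apply: eq_bdiag => i; rewrite sqrtmK.
Qed.

Lemma psd_bget A i : psd A -> psd (bget i A).
Proof. exact: psd_mxsub. Qed.

Lemma bgetB A B i : bget i (A - B) = bget i A - bget i B.
Proof. by apply/matrixP => k l; rewrite !mxE. Qed.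

Lemma bget1 i : bget i (1%:M : 'M[C]_(n * d)) = 1%:M.
Proof.
apply/matrixP => k l; rewrite bdiag_bget !mxE; congr (_%:R).
by rewrite (can_eq (@mxtens_indexK n d)) xpair_eqE eqxx.
Qed.

Lemma tensmx1l (s : 'M[C]_d) : tensmx (1%:M : 'M[C]_n) s = bdiag (fun=> s).
Proof.
apply: tens_matrixP => i j k l; rewrite tensmxE bdiagE mxE.
by case: eqP => _; rewrite ?mul1r ?mul0r.
Qed.

Lemma bdiag1 : bdiag (fun=> 1%:M) = 1%:M :> 'M[C]_(n * d).
Proof.
apply: tens_matrixP => i j k l; rewrite bdiagE !mxE (can_eq (@mxtens_indexK n d)) xpair_eqE.
by case: eqP => _.
Qed.

Lemma bdiagB F G : bdiag F - bdiag G = bdiag (fun i => F i - G i).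
Proof.
apply: tens_matrixP => i j k l; rewrite bdiagE mxE bdiagE mxE bdiagE.
by case: (i == j); rewrite ?subr0 // !mxE.
Qed.

Lemma bdiagZ (a : R) F : a%:C *: bdiag F = bdiag (fun i => a%:C *: F i).
Proof.
apply: tens_matrixP => i j k l; rewrite mxE !bdiagE mxE.
by case: eqP => _; rewrite ?mulr0.
Qed.

Lemma effect_bget A i : effect A -> effect (bget i A).
Proof.
case=> h1 h2; split; first exact: psd_bget.
by have := psd_bget i h2; rewrite bgetB bget1.
Qed.

Lemma effect_bdiag F : (forall i, effect (F i)) -> effect (bdiag F).
Proof.
move=> h; split; first by apply: psd_bdiag => i; case: (h i).
by rewrite /loew -bdiag1 bdiagB; apply: psd_bdiag => i; case: (h i).
Qed.

Lemma loew_bget A B i : loew A B -> loew (bget i A) (bget i B).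
Proof. by move=> h; rewrite /loew -bgetB; apply: psd_bget. Qed.
End Ops.

Lemma cqstateE (T : finType) d (P : T -> R) (th : T -> 'M[C]_d) :
  cqstate P th = bdiag (fun i => (P (enum_val i))%:C *: th (enum_val i)).
Proof.
apply: tens_matrixP => i j k l; rewrite bdiagE /cqstate summxE.
rewrite (bigD1 (enum_val i)) //= big1 => [|x ne].
  rewrite addr0 mxE tensmxE !mxE enum_valK eqxx /= eq_sym mulrA.
  by case: eqP => _; rewrite ?mulr1 // mulr0 mul0r.
rewrite mxE tensmxE mxE; case: eqP => [e|_]; last by rewrite mul0r mulr0.
by move: ne; rewrite -(enum_rankK x) -e eqxx.
Qed.

Lemma ptrZ_bdiag n b c (F : 'I_n -> 'M[C]_(b * c)) :
  ptrZ (bdiag F) = bdiag (fun i => ptr2 (F i)).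
Proof.
apply: tens_matrixP => i j k l; rewrite bdiagE mxE !mxtens_indexK /=.
under eq_bigr do rewrite bdiagE.
by case: (i == j); [rewrite mxE|rewrite big1].
Qed.

Lemma ptrY_bdiag n b c (F : 'I_n -> 'M[C]_(b * c)) :
  ptrY (bdiag F) = bdiag (fun i => ptr1 (F i)).
Proof.
apply: tens_matrixP => i j k l; rewrite bdiagE mxE !mxtens_indexK /=.
under eq_bigr do rewrite bdiagE.
by case: (i == j); [rewrite mxE|rewrite big1].
Qed.

Section PartialTrace.
Variables m n : nat.
Implicit Types A B : 'M[C]_(m * n).

Lemma ptr1E A : ptr1 A = \sum_i bget i A.
Proof.
by apply/matrixP => k l; rewrite mxE summxE; apply: eq_bigr => i _; rewrite bdiag_bget.
Qed.

Lemma ptr2E A : ptr2 A = \sum_k mxsub (fun i => idx (i, k)) (fun i => idx (i, k)) A.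
Proof.
by apply/matrixP => i j; rewrite mxE summxE; apply: eq_bigr => k _; rewrite mxE.
Qed.

Lemma mxtrace_ptr1 A : \tr (ptr1 A) = \tr A.
Proof.
rewrite /mxtrace big_tens exchange_big; apply: eq_bigr => k _.
by rewrite mxE.
Qed.

Lemma mxtrace_ptr2 A : \tr (ptr2 A) = \tr A.
Proof. by rewrite /mxtrace big_tens; apply: eq_bigr => k _; rewrite mxE. Qed.

Lemma qstate_ptr1 A : qstate A -> qstate (ptr1 A).
Proof.
case=> pA tA; split; last by rewrite mxtrace_ptr1.
by rewrite ptr1E; apply: psd_sum => i _; apply: psd_bget.
Qed.

Lemma qstate_ptr2 A : qstate A -> qstate (ptr2 A).
Proof.
case=> pA tA; split; last by rewrite mxtrace_ptr2.
by rewrite ptr2E; apply: psd_sum => i _; apply: psd_mxsub.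
Qed.

Lemma ptr1_lin (I : Type) (s : seq I) (w : I -> C) (F : I -> 'M[C]_(m * n)) :
  ptr1 (\sum_(i <- s) w i *: F i) = \sum_(i <- s) w i *: ptr1 (F i).
Proof.
apply/matrixP => k l; rewrite mxE summxE.
under eq_bigr do rewrite summxE.
rewrite exchange_big; apply: eq_bigr => i _; rewrite !mxE mulr_sumr.
by apply: eq_bigr => j _; rewrite mxE.
Qed.

Lemma ptr2_lin (I : Type) (s : seq I) (w : I -> C) (F : I -> 'M[C]_(m * n)) :
  ptr2 (\sum_(i <- s) w i *: F i) = \sum_(i <- s) w i *: ptr2 (F i).
Proof.
apply/matrixP => k l; rewrite mxE summxE.
under eq_bigr do rewrite summxE.
rewrite exchange_big; apply: eq_bigr => i _; rewrite !mxE mulr_sumr.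
by apply: eq_bigr => j _; rewrite mxE.
Qed.

Lemma ptr1Z (a : C) A : ptr1 (a *: A) = a *: ptr1 A.
Proof. by apply/matrixP => k l; rewrite !mxE mulr_sumr; apply: eq_bigr => j _; rewrite mxE. Qed.

Lemma ptr2Z (a : C) A : ptr2 (a *: A) = a *: ptr2 A.
Proof. by apply/matrixP => k l; rewrite !mxE mulr_sumr; apply: eq_bigr => j _; rewrite mxE. Qed.
End PartialTrace.

Lemma sum_enum_val (T : finType) (V : nmodType) (F : T -> V) :
  \sum_(i < #|T|) F (enum_val i) = \sum_x F x.
Proof. by symmetry; apply: reindex; apply: onW_bij; exact: enum_val_bij. Qed.


Lemma ptr2_cqstate (T : finType) d (P : T -> R) (th : T -> 'M[C]_d) :
  (forall x, qstate (th x)) ->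
  ptr2 (cqstate P th) = diag_mx (\row_i (P (enum_val i))%:C).
Proof.
move=> qth; apply/matrixP => i j; rewrite !mxE cqstateE.
under eq_bigr do rewrite bdiagE.
case: (i == j); last by rewrite big1.
under eq_bigr do rewrite mxE.
by rewrite -mulr_sumr -/(\tr (th (enum_val i))) (qth _).2 mulr1 mulr1n.
Qed.

Lemma qstate_mix (T : finType) d (P : T -> R) (th : T -> 'M[C]_d) :
  isdistr P -> (forall x, qstate (th x)) -> qstate (\sum_x (P x)%:C *: th x).
Proof.
move=> [P0 P1] qth; split; first by apply: psd_sum => x _; apply: psdZ => //; case: (qth x).
rewrite raddf_sum /=; under eq_bigr do rewrite mxtraceZ (qth _).2 mulr1.
by rewrite -(rmorph_sum (real_complex R)) P1.
Qed.

Lemma trR_mxtrace n (A : 'M[C]_n) : psd A -> \tr A = (trR A)%:C.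
Proof.
move=> pA; apply/eqP; rewrite eq_complex /= eqxx /=.
have : \tr A = conjc (\tr A) by rewrite -mxtrace_adjm psd_herm.
case: (\tr A) => a b [] /= h; move: h => /eqP; rewrite -addr_eq0 -mulr2n mulrn_eq0.
by [].
Qed.

Lemma qstate_bdiag n d (p : 'I_n -> R) (th : 'I_n -> 'M[C]_d) :
  isdistr p -> (forall i, qstate (th i)) -> qstate (bdiag (fun i => (p i)%:C *: th i)).
Proof.
move=> [p0 p1] qth.
have pB : psd (bdiag (fun i => (p i)%:C *: th i)).
  by apply: psd_bdiag => i; apply: psdZ => //; case: (qth i).
split; first exact: pB.
rewrite trR_mxtrace // trR_bdiag; under eq_bigr do rewrite trRZ qstate_trR // mulr1.
by rewrite p1.
Qed.
End Blocks.

(** * Converse bounds *)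

Section Converse.
Variable R : realType.
Local Notation C := R[i].

Lemma sum_fibers (I J : finType) (V : nmodType) (f : I -> J) (F : I -> V) :
  \sum_j \sum_(i | f i == j) F i = \sum_i F i.
Proof. by rewrite [RHS](partition_big f xpredT). Qed.

Lemma isdistr_unif (k : nat) : (0 < k)%N -> isdistr (fun _ : 'I_k => k%:R^-1 : R).
Proof.
move=> k0; split=> [i|]; first by rewrite invr_ge0.
by rewrite sumr_const card_ord -[LHS]mulr_natl divff // pnatr_eq0 -lt0n.
Qed.

Lemma loew_sum_term (I : finType) (d : nat) (F : I -> 'M[C]_d) (Q : pred I) i :
  Q i -> (forall j, psd (F j)) -> loew (F i) (\sum_(j | Q j) F j).
Proof.
move=> Qi pF; rewrite /loew (bigD1 i Qi) /= addrAC subrr add0r.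
by apply: psd_sum => j _; exact: pF.
Qed.

Lemma ln2_gt0 : 0 < ln (2 : R).
Proof. by rewrite ln_gt0 // ltr1n. Qed.

Lemma lg2_ler (x y : R) : 0 < x -> x <= y -> lg2 x <= lg2 y.
Proof.
move=> x0 xy; rewrite /lg2 ler_pM2r ?invr_gt0 ?ln2_gt0 // ler_ln ?posrE //.
exact: lt_le_trans xy.
Qed.

Lemma lg2V (x : R) : 0 < x -> lg2 x^-1 = - lg2 x.
Proof. by move=> x0; rewrite /lg2 lnV ?posrE // mulNr. Qed.

Lemma lg2_1 : lg2 (1 : R) = 0.
Proof. by rewrite /lg2 ln1 mul0r. Qed.

Lemma elg2_le (x : \bar R) (y : R) : 0 < y -> (x <= y%:E)%E -> (elg2 x <= (lg2 y)%:E)%E.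
Proof.
case: x => [x| |] y0 //=; rewrite ?leNye // lee_fin => xy.
by case: (leP x 0) => x0; rewrite ?leNye // lee_fin lg2_ler.
Qed.

Lemma Hmin_ge (dA dB : nat) (rho : 'M[C]_(dA * dB)) (s : 'M[C]_dB) (l : R) :
  0 < l -> qstate s -> loew rho (l%:C *: tensmx (1%:M : 'M[C]_dA) s) ->
  ((- lg2 l)%:E <= Hmin rho)%E.
Proof.
move=> l0 qs h; apply: le_ereal_sup_tmp.
exists (- elg2 (ereal_inf [set (lam%:E)%E | lam in [set lam : R |
  loew rho (lam%:C *: (tensmx (1%:M : 'M[C]_dA) s))]]))%E; first by exists s.
rewrite EFinN leeN2 elg2_le //; apply: ge_ereal_inf; exists l%:E => //.
by exists l.
Qed.

Lemma HminU_ge (d : nat) (rho : 'M[C]_d) (l : R) :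
  0 < l -> loew rho (l%:C *: 1%:M) -> ((- lg2 l)%:E <= HminU rho)%E.
Proof.
move=> l0 h; rewrite /HminU EFinN leeN2 elg2_le //; apply: ge_ereal_inf; exists l%:E => //.
by exists l.
Qed.

Lemma Hmax_le0 (dA dB : nat) (rho : 'M[C]_(dA * dB)) :
  (forall s : 'M[C]_dB, qstate s -> fid rho (tensmx 1%:M s) <= 1) -> (Hmax rho <= 0)%E.
Proof.
move=> h; apply: ge_ereal_sup => _ [s qs <-] /=.
case: (leP (fid _ _) 0) => [_|f0]; first by rewrite gt0_muleNy ?leNye // lte_fin.
rewrite -EFinM lee_fin mulr_ge0_le0 // -lg2_1 lg2_ler //.
exact: h.
Qed.

(** For [eps <= 1], [1 - (1 - eps)^2 <= 2 eps]; for larger [eps], already [1 <= 2 eps]. *)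
Lemma pdist_le (n : nat) (r t : 'M[C]_n) (eps : R) :
  1 - eps <= fid r t -> pdist r t <= Num.sqrt (2 * eps).
Proof.
move=> h; apply: ler_wsqrtr; have := fid_ge0 r t; move: h; move: (fid r t) => F h F0.
have [e1|e1] := leP eps 1; nra.
Qed.

(** The fidelity depends only on [sqrt t r sqrt t], so any factor [A B] with this Gram matrix may
    replace [sqrt r sqrt t]. No formula for [sqrt r] is then required. *)
Lemma fid_le_holder (n : nat) (r t A B : 'M[C]_n) : psd r -> psd t ->
  sqrtm t *m r *m sqrtm t = adjm (A *m B) *m (A *m B) ->
  fid r t <= Num.sqrt (trR (A *m adjm A)) * Num.sqrt (trR (adjm B *m B)).
Proof. by move=> pr pt e; rewrite fidE // e; exact: tnorm_holder. Qed.

Section Measurement.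
Variables (n d : nat) (p : 'I_n -> R) (th D : 'I_n -> 'M[C]_d) (eps : R).
Hypotheses (hp : isdistr p) (qth : forall i, qstate (th i)).
Hypotheses (pD : forall i, psd (D i)) (D1 : loew (\sum_i D i) 1%:M).
Hypothesis succ : 1 - eps <= \sum_i p i * trR (D i *m th i).

Let p0 i : 0 <= p i. Proof. by case: hp. Qed.
Let pth i : psd (th i). Proof. by case: (qth i). Qed.

Let effD i : effect (D i).
Proof.
split; first exact: pD.
by apply: loew_trans D1; exact: loew_sum_term.
Qed.

Let rb := bdiag (fun i => (p i)%:C *: (sqrtm (D i) *m th i *m sqrtm (D i))).
Let psi := bdiag (fun i => (p i)%:C *: th i).

Let psdth i : psd (sqrtm (D i) *m th i *m sqrtm (D i)).
Proof. by have := psd_conj (sqrtm (D i)) (pth i); rewrite sqrtm_herm. Qed.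

Let psd_rb : psd rb.
Proof. by apply: psd_bdiag => i; exact: psdZ (p0 i) (psdth i). Qed.

Let psd_psi : psd psi.
Proof. by apply: psd_bdiag => i; exact: psdZ (p0 i) (pth i). Qed.

Let sqrt_psi : sqrtm psi = bdiag (fun i => (Num.sqrt (p i))%:C *: sqrtm (th i)).
Proof.
rewrite sqrtm_bdiag => [|i]; last exact: psdZ (p0 i) (pth i).
by apply: eq_bdiag => i; rewrite sqrtmZ.
Qed.

Let trR_dth i : trR (sqrtm (D i) *m th i *m sqrtm (D i)) = trR (D i *m th i).
Proof. by rewrite trRC mulmxA sqrtmK. Qed.

Let subn_rb : subnormalized rb.
Proof.
split; first exact: psd_rb.
rewrite trR_bdiag -(proj2 hp); apply: ler_sum => i _.
rewrite trRZ trR_dth -[leRHS]mulr1 ler_wpM2l //.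
by have /andP[_] := effect_trR (effD i) (pth i); rewrite (qstate_trR (qth i)).
Qed.

(* The gentle measurement argument: [sqrt psi rb sqrt psi] is the square of the
   block matrix with blocks [p sqrt th sqrt D sqrt th], and [D <= sqrt D]. *)
Let fid_rb : 1 - eps <= fid psi rb.
Proof.
rewrite fid_sym // fidE // sqrt_psi /rb !bdiagM.
rewrite (@sqrtm_uniq _ _ _ (bdiag (fun i => (p i)%:C *: (sqrtm (th i) *m sqrtm (D i) *m sqrtm (th i))))).
  apply: le_trans succ _; rewrite trR_bdiag; apply: ler_sum => i _.
  rewrite trRZ ler_wpM2l // [leRHS]trRC mulmxA sqrtmK // [leRHS]trRC.
  apply: loew_trR (pth i).
  have sD : effect (sqrtm (D i)).
    split; first exact: psd_sqrtm.
    apply: sqr_loew; [exact: psd_sqrtm|exact: psd1|rewrite (sqrtmK (pD i)) mulmx1].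
    by case: (effD i).
  by have := effect_sqr sD; rewrite sqrtmK.
  apply: psd_bdiag => i; apply: (psdZ (p0 i)).
  by have := psd_conj (sqrtm (th i)) (psd_sqrtm (pD i)); rewrite sqrtm_herm.
rewrite bdiagM; apply: eq_bdiag => i.
rewrite -!scalemxAl -!scalemxAr -!scalemxAl !scalerA -!rmorphM /=; congr (_%:C *: _).
  by rewrite [in RHS]mulrA -(expr2 (Num.sqrt (p i))) sqr_sqrtr.
by rewrite -!mulmxA (mulmxA (sqrtm (th i)) (sqrtm (th i))) (sqrtmK (pth i)).
Qed.

(** Hoelder with [A = sqrt psi] and [B] of blocks [sqrt (D i) sqrt s]: [tr A A* = tr psi = 1], and
    [tr B* B = sum_i tr (D i s) <= 1] because the [D i] sum to at most the identity. *)
Let Hmax_rb : (Hmax rb <= 0)%E.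
Proof.
apply: Hmax_le0 => s qs; rewrite tensmx1l.
have ps : psd s by case: qs.
have pB : psd (bdiag (fun=> s) : 'M[C]_(n * d)) by apply: psd_bdiag => _; exact: ps.
apply: le_trans (@fid_le_holder _ _ _
  (bdiag (fun i => (Num.sqrt (p i))%:C *: sqrtm (th i)))
  (bdiag (fun i => sqrtm (D i) *m sqrtm s)) psd_rb pB _) _.
  rewrite sqrtm_bdiag => [|_]; last exact: ps.
  rewrite !bdiagM bdiag_adjm bdiagM; apply: eq_bdiag => i.
  rewrite -!scalemxAl -!scalemxAr adjmZ !adjmM (sqrtm_herm ps) (sqrtm_herm (pD i)).
  rewrite (sqrtm_herm (pth i)) -!scalemxAl !scalerA -rmorphM /= -expr2 (sqr_sqrtr (p0 i)).
  congr (_ *: _).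
  by rewrite -!mulmxA (mulmxA (sqrtm (th i)) (sqrtm (th i))) (sqrtmK (pth i)).
rewrite -sqrt_psi (sqrtm_herm psd_psi) (sqrtmK psd_psi) (qstate_trR (qstate_bdiag hp qth)).
rewrite sqrtr1 mul1r -[leRHS]sqrtr1 ler_wsqrtr //.
rewrite bdiag_adjm bdiagM trR_bdiag.
rewrite (eq_bigr (fun i => trR (D i *m s))) => [|i _].
  rewrite -trR_sum -mulmx_suml -(qstate_trR qs) -[X in _ <= trR X]mul1mx.
  exact: loew_trR D1 ps.
rewrite adjmM (sqrtm_herm ps) (sqrtm_herm (pD i)) -mulmxA [sqrtm (D i) *m _]mulmxA.
by rewrite (sqrtmK (pD i)) trRC -mulmxA (sqrtmK ps).
Qed.

Lemma sHmax_le0 : (sHmax (Num.sqrt (2 * eps)) psi <= 0)%E.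
Proof.
apply: ge_ereal_inf; exists (Hmax rb); last exact: Hmax_rb.
by exists rb; [split; [exact: subn_rb|exact: pdist_le fid_rb]|].
Qed.
End Measurement.

(** The smoothed state has the average [zb] in every block; taking [sigma = zb] gives min-entropy at
    least [log k]. Its fidelity with the given state is estimated block by block through
    [tnorm_sqrtm]. *)
Lemma sHmin_uniform_ge (k d : nat) (z : 'I_k -> 'M[C]_d) (eps : R) : (0 < k)%N ->
  (forall i, qstate (z i)) ->
  (forall i, tnorm (z i - (k%:R^-1)%:C *: \sum_j z j) / 2 <= eps) ->
  ((lg2 k%:R)%:E <= sHmin (Num.sqrt (2 * eps)) (bdiag (fun i => (k%:R^-1 : R)%:C *: z i)))%E.
Proof.
move=> k0 qz hz; set a : R := k%:R^-1.
have kR0 : 0 < k%:R :> R by rewrite ltr0n.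
have a0 : 0 < a by rewrite invr_gt0.
have da : isdistr (fun _ : 'I_k => a) by exact: isdistr_unif.
set zb := _ *: _ in hz.
have qzb : qstate zb by rewrite /zb scaler_sumr; exact: qstate_mix.
have pz i : psd (z i) by case: (qz i).
have pzb : psd zb by case: qzb.
pose rb := bdiag (fun _ : 'I_k => a%:C *: zb).
have qrb : qstate rb by exact: qstate_bdiag.
apply: (@le_trans _ _ (Hmin rb)).
  rewrite -[lg2 _]opprK -lg2V // -/a; apply: (Hmin_ge a0 qzb).
  by rewrite tensmx1l bdiagZ; apply: loew_refl.
apply: le_ereal_sup_tmp; exists (Hmin rb) => //; exists rb => //; split.
  by split; [case: qrb|rewrite qstate_trR].
apply: pdist_le; apply: le_trans (trR_sqrtm_le_fid _ _).
rewrite !sqrtm_bdiag => [|i|i]; try by apply: psdZ => //; exact: ltW.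
rewrite bdiagM trR_bdiag.
have -> : 1 - eps = \sum_(i < k) a * (1 - eps) by rewrite -mulr_suml (proj2 da) mul1r.
apply: ler_sum => i _.
rewrite (sqrtmZ (ltW a0) (pz i)) (sqrtmZ (ltW a0) pzb) -scalemxAl -scalemxAr scalerA -rmorphM /= -expr2 (sqr_sqrtr (ltW a0)).
rewrite trRZ (ler_wpM2l (ltW a0)) //; apply: le_trans (tnorm_sqrtm (qz i) qzb).
by rewrite lerD2l lerN2.
Qed.

Section TrivialBall.
Variables (dA dB : nat) (psi : 'M[C]_(dA * dB)) (eps : R).
Hypotheses (heps : 2^-1 <= eps).

Let ball0 : sball (Num.sqrt (2 * eps)) psi 0.
Proof.
split; first by split; [exact: psd0|rewrite trR0].
by apply: ler_wsqrtr; have := sqr_ge0 (fid psi 0); move: heps; move: (_ ^+ 2) => *; lra.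
Qed.

(** The radius is at least 1, so the ball contains the zero operator, whose fidelities vanish and
    have logarithm [-oo]. *)
Lemma sHmax_trivial : sHmax (Num.sqrt (2 * eps)) psi = -oo%E.
Proof.
apply/eqP; rewrite -leeNy_eq; apply: ge_ereal_inf; exists (Hmax (0 : 'M[C]_(dA * dB))).
  by exists 0.
apply: ge_ereal_sup => _ [s qs <-] /=.
have -> : fid (0 : 'M[C]_(dA * dB)) (tensmx 1%:M s) = 0.
  by rewrite /fid (@sqrtm_uniq _ _ _ 0) ?mul0mx ?tnorm0 //; exact: psd0.
by rewrite lexx gt0_muleNy // lte_fin.
Qed.

End TrivialBall.

Lemma public_converse (X : finType) (eps : R) (d : nat) (th : X -> 'M[C]_d) :
  (forall x, qstate (th x)) ->
  (Cpub eps th <= ereal_sup [set (HminU (ptr2 (cqstate P th))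
                      - sHmax (Num.sqrt (2 * eps)) (cqstate P th))%E
                 | P in [set P : X -> R | isdistr P]])%E.
Proof.
move=> qth; apply: ge_ereal_sup => _ [k [k0 [enc [D [[pD D1] herr]]]] <-] /=.
have kR0 : 0 < k%:R :> R by rewrite ltr0n.
pose P x : R := \sum_(m | enc m == x) k%:R^-1.
have a0 : 0 < k%:R^-1 :> R by rewrite invr_gt0.
have P0 x : 0 <= P x by rewrite sumr_ge0 // => m _; exact: ltW.
have P1 : \sum_x P x = 1.
  by rewrite sum_fibers; case: (isdistr_unif k0).
have P1' x : P x <= 1 by rewrite -P1 (bigD1 x) //= lerDl sumr_ge0.
apply: le_ereal_sup_tmp; eexists; first by exists P; [split|].
rewrite ptr2_cqstate //.
(* For [eps >= 1/2] the right-hand side is [HminU - (-oo)]. It equals [+oo] once [HminU] is known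
   not to be [-oo]. *)
have [e2|e2] := leP 2^-1 eps.
  rewrite sHmax_trivial //.
  have := HminU_ge ltr01 (loew_diag_mx (fun i : 'I_#|X| => P1' (enum_val i))).
  by rewrite lg2_1 oppr0; case: HminU => [x| |] //= _; rewrite leey.
have pth x : psd (th x) by case: (qth x).
have succ m : 1 - eps <= trR (D m *m th (enc m)).
  by have := herr m; rewrite /perr; move: (trR _) => *; lra.
(* Two messages with the same input would each be decoded with probability above 1/2, more than the
   total 1. Injectivity is what makes [P] at most [1/k]. *)
have inj : injective enc.
  move=> m m' e; apply/eqP/negPn/negP => ne.
  have : trR (D m *m th (enc m)) + trR (D m' *m th (enc m')) <= 1.
    rewrite -e -trRD -mulmxDl -(qstate_trR (qth (enc m))) -[X in _ <= trR X]mul1mx -D1.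
    apply: loew_trR (pth _); rewrite /loew (bigD1 m) //= (bigD1 m') 1?eq_sym //=.
    by rewrite (addrA (D m)) [_ + _ - _]addrAC subrr add0r; apply: psd_sum => j _; exact: pD.
  by have := succ m; have := succ m'; clear D1; move: (trR _) (trR _) => *; lra.
have Pk x : P x <= k%:R^-1.
  rewrite /P; case: (pickP (fun m => enc m == x)) => [m /eqP em|no].
    by rewrite (big_pred1 m) // => m'; rewrite -em (inj_eq inj).
  by rewrite big_pred0 // ltW.
rewrite -[leLHS]sube0; apply: leeB.
  rewrite -[lg2 _]opprK -lg2V //.
  exact: HminU_ge a0 (loew_diag_mx (fun i : 'I_#|X| => Pk (enum_val i))).
rewrite cqstateE.
(* The decoder is re-indexed by input letters, the classical register being [X] rather than the
   message. *)
pose D' x := \sum_(m | enc m == x) D m.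
have pD' x : psd (D' x) by apply: psd_sum => m _; exact: pD.
apply: (@sHmax_le0 _ _ _ _ (fun i : 'I_#|X| => D' (enum_val i))).
- by split=> [i|]; [exact: P0|rewrite sum_enum_val].
- by move=> i; exact: qth.
- by move=> i; exact: pD'.
- rewrite (sum_enum_val D') sum_fibers D1.
  exact: loew_refl.
rewrite (sum_enum_val (fun x => P x * trR (D' x *m th x))).
have -> : \sum_x P x * trR (D' x *m th x)
   = \sum_m k%:R^-1 * trR (D' (enc m) *m th (enc m)).
  rewrite (partition_big enc xpredT) //=; apply: eq_bigr => x _.
  by rewrite mulr_suml; apply: eq_bigr => m /eqP ->.
have -> : 1 - eps = \sum_(m < k) k%:R^-1 * (1 - eps).
  by rewrite -mulr_suml (proj2 (isdistr_unif k0)) mul1r.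
apply: ler_sum => m _; rewrite (ler_wpM2l (ltW a0)) //; apply: le_trans (succ m) _.
by apply: loew_trR (pth _); apply: loew_sum_term.
Qed.

Lemma private_converse (X : finType) (eps : R) (dY dZ : nat) (th : X -> 'M[C]_(dY * dZ)) :
  (forall x, qstate (th x)) ->
  (Cprv eps th <=
        ereal_sup [set r | exists (t : nat) (PT : 'I_t -> R) (W : 'I_t -> X -> R),
                   isdistr PT /\ (forall tau, isdistr (W tau)) /\
                   r = (sHmin (Num.sqrt (2 * eps)) (ptrY (tstate PT W th))
                        - sHmax (Num.sqrt (2 * eps)) (ptrZ (tstate PT W th)))%E])%E.
Proof.
move=> qth; apply: ge_ereal_sup => _ [k [k0 [E [D [hE [[pD D1] [herr hsec]]]]]] <-] /=.
have kR0 : 0 < k%:R :> R by rewrite ltr0n.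
have a0 : 0 < k%:R^-1 :> R by rewrite invr_gt0.
apply: le_ereal_sup_tmp; eexists.
  (* [T] is the message itself and the randomized encoder is the map from [T] to [X]. *)
  exists k, (fun=> k%:R^-1), E; split; last by split.
  exact: isdistr_unif.
rewrite /tstate cqstateE ptrY_bdiag ptrZ_bdiag.
have qenc m : qstate (encout th E m) by exact: qstate_mix.
have ck : #|'I_k|%:R = k%:R :> R by rewrite card_ord.
rewrite -[leLHS]sube0; apply: leeB.
  have := @sHmin_uniform_ge #|'I_k| dZ (fun i => ptr1 (encout th E (enum_val i))) eps.
  rewrite ck => h; apply: le_trans (h _ _ _) _; first by rewrite card_ord.
  - by move=> i; exact: qstate_ptr1.
  - move=> i; rewrite (sum_enum_val (fun m => ptr1 (encout th E m))).
    by have := hsec (enum_val i); rewrite fmorphV rmorph_nat.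
  rewrite (@eq_bdiag _ _ _ _ (fun i => ptr1 ((k%:R^-1)%:C *: encout th E (enum_val i)))) //.
  by move=> i; rewrite ptr1Z.
rewrite (@eq_bdiag _ _ _ _ (fun i => (k%:R^-1)%:C *: ptr2 (encout th E (enum_val i)))); last first.
  by move=> i; rewrite ptr2Z.
apply: (@sHmax_le0 _ _ _ _ (fun i : 'I_#|'I_k| => D (enum_val i))).
- by rewrite -ck; apply: isdistr_unif; rewrite card_ord.
- by move=> i; exact: qstate_ptr2.
- by move=> i; exact: pD.
- by rewrite (sum_enum_val D) D1; exact: loew_refl.
rewrite (sum_enum_val (fun m => k%:R^-1 * trR (D m *m ptr2 (encout th E m)))).
have -> : 1 - eps = \sum_(m < k) k%:R^-1 * (1 - eps).
  by rewrite -mulr_suml (proj2 (isdistr_unif k0)) mul1r.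
apply: ler_sum => m _; rewrite (ler_wpM2l (ltW a0)) //.
by have := herr m; move: (trR _) => *; lra.
Qed.
End Converse.

(** * Tests, random binning and the bin decoder *)

Section Achievability.
Variable R : realType.
Local Notation C := R[i].

Lemma loew_trRr n (A B D : 'M[C]_n) : loew A B -> psd D -> trR (D *m A) <= trR (D *m B).
Proof. by move=> h pD; rewrite [trR (D *m A)]trRC [trR (D *m B)]trRC; exact: loew_trR. Qed.

Lemma ex_le_mean (H : finType) (w f : H -> R) :
  isdistr w -> exists h, f h <= \sum_h w h * f h.
Proof.
move=> [w0 w1]; set m := \sum_h _.
have [[h hh]|no] := pselect (exists h, f h <= m); first by exists h.
have gt h : m < f h by rewrite ltNge; apply/negP => hh; apply: no; exists h.
have : \sum_h w h * (f h - m) = 0.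
  under eq_bigr do rewrite mulrBr.
  by rewrite sumrB -mulr_suml w1 mul1r subrr.
move=> /eqP; rewrite psumr_eq0 => [|h _]; last by rewrite mulr_ge0 // subr_ge0 ltW.
move=> /allP h0; move: w1; rewrite big1 => [/eqP|h _]; first by rewrite eq_sym oner_eq0.
have := h0 h (mem_index_enum h); rewrite /= mulf_eq0 subr_eq0.
by rewrite (gt_eqF (gt h)) orbF => /eqP.
Qed.

(** * Averages over a uniformly random function *)

Section RandomFunction.
Variables (T J : finType).
Hypothesis J0 : (0 < #|J|)%N.

(** The uniform weight is written as a product over [T], so that the expectation of a product over
    the arguments factorises. *)
Definition avg (f : {ffun T -> J} -> R) : R :=
  \sum_h (\prod_(i : T) (#|J|%:R^-1 : R)) * f h.

Let JR : #|J|%:R != 0 :> R. Proof. by rewrite pnatr_eq0 -lt0n. Qed.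

Lemma avg_prod (F : T -> J -> R) :
  avg (fun h => \prod_i F i (h i)) = \prod_i (#|J|%:R^-1 * \sum_j F i j).
Proof.
rewrite /avg (eq_bigr (fun h : {ffun T -> J} => \prod_i (#|J|%:R^-1 * F i (h i)))) => [|h _].
  rewrite -(bigA_distr_bigA (fun i j => #|J|%:R^-1 * F i j)).
  by apply: eq_bigr => i _; rewrite mulr_sumr.
by rewrite big_split.
Qed.

Lemma avg_weight : isdistr (fun _ : {ffun T -> J} => \prod_(i : T) (#|J|%:R^-1 : R)).
Proof.
split=> [h|]; first by apply: prodr_ge0 => i _; rewrite invr_ge0.
transitivity (avg (fun=> \prod_(i : T) (1 : R))).
  by apply: eq_bigr => h _; rewrite big1_eq mulr1.
by rewrite (avg_prod (fun _ _ => 1)) big1 // => i _; rewrite sumr_const mulVf.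
Qed.

Lemma avg_le (f g : {ffun T -> J} -> R) : (forall h, f h <= g h) -> avg f <= avg g.
Proof. by move=> fg; apply: ler_sum => h _; apply: ler_wpM2l (fg h); exact: (proj1 avg_weight h). Qed.

Lemma avgD (f g : {ffun T -> J} -> R) : avg (fun h => f h + g h) = avg f + avg g.
Proof. by rewrite /avg -big_split; apply: eq_bigr => h _; rewrite mulrDr. Qed.

Lemma avgZ (a : R) (f : {ffun T -> J} -> R) : avg (fun h => a * f h) = a * avg f.
Proof. by rewrite /avg mulr_sumr; apply: eq_bigr => h _; rewrite mulrCA. Qed.

Lemma avg_cst (a : R) : avg (fun=> a) = a.
Proof. by rewrite /avg -mulr_suml (proj2 avg_weight) mul1r. Qed.

Lemma eq_avg (f g : {ffun T -> J} -> R) : f =1 g -> avg f = avg g.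
Proof. by move=> e; apply: eq_bigr => h _; rewrite e. Qed.

Lemma avg_sum (I : finType) (Q : pred I) (f : I -> {ffun T -> J} -> R) :
  avg (fun h => \sum_(i | Q i) f i h) = \sum_(i | Q i) avg (f i).
Proof.
rewrite /avg [RHS]exchange_big; apply: eq_bigr => h _.
by rewrite mulr_sumr.
Qed.

Lemma ex_le_avg (f : {ffun T -> J} -> R) : exists h, f h <= avg f.
Proof. exact: ex_le_mean avg_weight. Qed.

Lemma avg1 (F : J -> R) t : avg (fun h => F (h t)) = #|J|%:R^-1 * \sum_j F j.
Proof.
pose G i j : R := if i == t then F j else 1.
have := avg_prod G; rewrite (bigD1 t) //= [X in _ * X]big1 => [|i it].
  rewrite mulr1 => e; rewrite (@eq_avg _ (fun h => \prod_i G i (h i))) => [|h].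
    by rewrite e; congr (_ * _); apply: eq_bigr => j _; rewrite /G eqxx.
  rewrite (bigD1 t) //= big1 => [|i it]; rewrite /G ?eqxx ?mulr1 //.
  by rewrite (negPf it).
by rewrite /G (negPf it) sumr_const mulVf.
Qed.

(** Independence of the values at two points: put the factor 1 at every other argument and use
    [avg_prod]. *)
Lemma avg2 (F1 F2 : J -> R) t1 t2 : t1 != t2 ->
  avg (fun h => F1 (h t1) * F2 (h t2))
  = (#|J|%:R^-1 * \sum_j F1 j) * (#|J|%:R^-1 * \sum_j F2 j).
Proof.
move=> ne; pose G i j : R := if i == t1 then F1 j else if i == t2 then F2 j else 1.
have ne' : t2 != t1 by rewrite eq_sym.
have := avg_prod G; rewrite (bigD1 t1) // (bigD1 t2) //= [X in _ * (_ * X)]big1 => [|i /andP[i1 i2]].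
  rewrite mulr1 => e; rewrite (@eq_avg _ (fun h => \prod_i G i (h i))) => [|h].
    by rewrite e /G eqxx (negPf ne') eqxx.
  rewrite (bigD1 t1) // (bigD1 t2) //= [X in _ * (_ * X)]big1 => [|i /andP[i1 i2]].
    by rewrite /G ?eqxx (negPf ne') ?eqxx mulr1.
  by rewrite /G (negPf i1) (negPf i2).
by rewrite /G (negPf i1) (negPf i2) sumr_const mulVf.
Qed.
End RandomFunction.

Section Binning.
Variables (T : finType) (N L : nat).
Hypotheses (N0 : (0 < N)%N) (L0 : (0 < L)%N).
Local Notation J := ('I_N * 'I_L)%type.

Let cardJ : #|{: J}| = (N * L)%N. Proof. by rewrite card_prod !card_ord. Qed.
Lemma card_bins_gt0 : (0 < #|{: J}|)%N. Proof. by rewrite cardJ muln_gt0 N0. Qed.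

Lemma avg_collision t1 t2 : t1 != t2 ->
  avg (fun h : {ffun T -> J} => ((h t1).2 == (h t2).2)%:R) = L%:R^-1.
Proof.
move=> ne.
rewrite (@eq_avg _ _ _ (fun h : {ffun T -> J} =>
  \sum_(c < L) ((h t1).2 == c)%:R * ((h t2).2 == c)%:R)) => [|h]; last first.
  rewrite (bigD1 (h t1).2) //= eqxx mul1r big1 => [|c hc].
    by rewrite addr0 eq_sym.
  by rewrite eq_sym (negPf hc) mul0r.
rewrite avg_sum.
under eq_bigr do rewrite (avg2 card_bins_gt0 (fun j : J => (j.2 == _)%:R) (fun j : J => (j.2 == _)%:R) ne).
have e (c : 'I_L) : #|{: J}|%:R^-1 * \sum_(j : J) (j.2 == c)%:R = L%:R^-1 :> R.
  rewrite -(pair_bigA _ (fun (m : 'I_N) (c' : 'I_L) => (c' == c)%:R)) /=.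
  rewrite (eq_bigr (fun=> 1)) => [|m _].
    rewrite sumr_const card_ord cardJ natrM invfM mulrC mulrA divff ?mul1r //.
    by rewrite pnatr_eq0 -lt0n.
  by rewrite (bigD1 c) //= eqxx big1 ?addr0 // => c' /negPf ->.
under eq_bigr do rewrite !e.
rewrite sumr_const card_ord -[LHS]mulr_natl mulrA divff ?mul1r //.
by rewrite pnatr_eq0 -lt0n.
Qed.
End Binning.

(** The missing part of the identity is assigned to outcome 0, which can only raise acceptance
    probabilities. *)
Lemma povm_complete k d (D : 'I_k -> 'M[C]_d) : (0 < k)%N ->
  (forall m, psd (D m)) -> loew (\sum_m D m) 1%:M ->
  exists D' : 'I_k -> 'M[C]_d, povm D' /\
    forall m (t : 'M[C]_d), psd t -> trR (D m *m t) <= trR (D' m *m t).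
Proof.
case: k D => // k D _ pD D1; pose rest := 1%:M - \sum_m D m.
pose D' m := D m + (if m == ord0 then rest else 0).
have pr m : psd (if m == ord0 :> 'I_k.+1 then rest else 0).
  by case: (m == ord0); [exact: D1|exact: psd0].
exists D'; split; [split|].
- by move=> m; exact: psdD (pD m) (pr m).
- rewrite big_split /= (bigD1 ord0 (F := fun m => if m == ord0 then rest else 0)) //=.
  rewrite [X in _ + (_ + X)]big1 => [|m /negPf ->] //.
  by rewrite addr0 addrC subrK.
move=> m t pt; rewrite mulmxDl trRD lerDl; exact: trR_psdM (pr m) pt.
Qed.

Section Test.
Variables (n d : nat) (p : 'I_n -> R) (th : 'I_n -> 'M[C]_d).
Variables (rb : 'M[C]_(n * d)) (a mu e : R).
Hypotheses (hp : isdistr p) (qth : forall i, qstate (th i)).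
Hypotheses (sub_rb : subnormalized rb) (mu0 : 0 < mu) (e0 : 0 < e).
Hypothesis near : pdist (bdiag (fun i => (p i)%:C *: th i)) rb <= a.
Hypothesis fidrb : forall s : 'M[C]_d, qstate s -> fid rb (tensmx 1%:M s) <= Num.sqrt mu.

Let sg := \sum_i (p i)%:C *: th i.

(* The test compares [rb] with [kappa (1 (x) sg)] where [kappa = e^2 / mu]. *)
Lemma decoding_test : exists Lam : 'I_n -> 'M[C]_d,
  [/\ forall i, effect (Lam i),
      \sum_i p i * (1 - trR (Lam i *m th i)) <= e + a &
      \sum_i trR (Lam i *m sg) <= mu / e].
Proof.
have qsg : qstate sg by exact: qstate_mix.
have psg : psd sg by case: qsg.
have prb : psd rb by case: sub_rb.
pose kap := e ^+ 2 / mu.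
have kap0 : 0 < kap by rewrite divr_gt0 ?exprn_gt0.
have ptau : psd (bdiag (fun _ : 'I_n => sg)) by apply: psd_bdiag.
have [Pi [ePi hPi]] := powers_stormer prb (psdZ (ltW kap0) ptau).
(* The fidelity hypothesis at [sg] bounds the right-hand side by [sqrt (kap mu) = e], so the mass of
   [rb] rejected by [Pi] and [kap] times the product mass that it accepts are both at most [e]. *)
have {}hPi : trR rb - trR (Pi *m rb) + kap * trR (Pi *m bdiag (fun _ : 'I_n => sg)) <= e.
  apply: le_trans (le_trans _ hPi) _; first by rewrite -scalemxAr trRZ.
  rewrite (sqrtmZ (ltW kap0) ptau) -scalemxAr trRZ.
  have := fidrb qsg; rewrite tensmx1l => hf.
  apply: (@le_trans _ _ (Num.sqrt kap * Num.sqrt mu)).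
    by rewrite ler_wpM2l ?sqrtr_ge0 //; apply: le_trans (trR_sqrtm_le_fid _ _) hf.
  by rewrite -(sqrtrM _ (ltW kap0)) /kap divfK ?gt_eqF // sqrtr_sqr ger0_norm // ltW.
have qpsi := qstate_bdiag hp qth.
exists (fun i => bget i Pi); split.
- by move=> i; exact: effect_bget.
(* Passing from [rb] back to the true state changes the rejection probability by at most [a]. *)
- have := pdist_meas qpsi sub_rb near (effectC ePi).
  rewrite !mulmxBl !mul1mx !trRB (qstate_trR qpsi) [trR (Pi *m bdiag _)]trRC trR_bdiagM.
  have /andP[x0 _] := effect_trR ePi ptau.
  have -> : \sum_i p i * (1 - trR (bget i Pi *m th i))
    = 1 - \sum_i trR ((p i)%:C *: th i *m bget i Pi).
    under eq_bigr do rewrite mulrBr mulr1.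
    rewrite sumrB (proj2 hp); congr (_ - _); apply: eq_bigr => i _.
    by rewrite -scalemxAl trRZ trRC.
  move: hPi x0; move: (trR _) (trR _) (trR _) (\sum_i _) => x y z w hPi x0.
  rewrite ler_norml => /andP[_ h].
  have := mulr_ge0 (ltW kap0) x0; lra.
have /andP[x0 x1] := effect_trR ePi prb.
have hk : kap * trR (Pi *m bdiag (fun _ : 'I_n => sg)) <= e.
  by move: hPi x1; move: (trR _) (trR _) (trR _) => *; lra.
have -> : \sum_i trR (bget i Pi *m sg) = trR (Pi *m bdiag (fun _ : 'I_n => sg)).
  by rewrite [RHS]trRC trR_bdiagM; apply: eq_bigr => i _; rewrite trRC.
rewrite -(ler_pM2l kap0); apply: le_trans hk _; rewrite /kap expr2.
by rewrite mulrA -[_ / mu * mu]mulrA mulVf ?gt_eqF // mulr1 mulfK ?gt_eqF.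
Qed.

(** Since [p i th i <= sg], the tests accept [sg] with total weight at least [1 - e - a]. The
    resulting lower bound on [mu] ensures that the intended number of bins is at least 1 before
    rounding. *)
Lemma test_weight (Lam : 'I_n -> 'M[C]_d) :
  (forall i, effect (Lam i)) ->
  \sum_i p i * (1 - trR (Lam i *m th i)) <= e + a ->
  \sum_i trR (Lam i *m sg) <= mu / e -> (1 - e - a) * e <= mu.
Proof.
move=> eL h1 h2; rewrite -ler_pdivlMr //; apply: le_trans h2.
have : \sum_i p i * trR (Lam i *m th i) <= \sum_i trR (Lam i *m sg).
  apply: ler_sum => i _; rewrite -trRZ scalemxAr.
  apply: loew_trRr; last by case: (eL i).
  apply: (@loew_sum_term _ _ _ (fun i => (p i)%:C *: th i)) => // j.
  by apply: psdZ; [case: hp|case: (qth j)].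
move: h1; under eq_bigr do rewrite mulrBr mulr1.
rewrite sumrB (proj2 hp); move: (\sum_i _) (\sum_i _) => *; lra.
Qed.
End Test.

(** Square-root measurement of the tests of one bin [S], regularised by [eta]. The regulariser has
    expectation [eta] in the state [th t], whence the term [4 eta]. *)
Lemma bin_decoder n d (Lam th : 'I_n -> 'M[C]_d) (eta : R) (S : pred 'I_n) :
  (forall i, effect (Lam i)) -> (forall i, qstate (th i)) -> 0 < eta ->
  exists D : 'I_n -> 'M[C]_d,
  [/\ forall t, psd (D t), loew (\sum_(t | S t) D t) 1%:M &
      forall t, S t -> 1 - trR (D t *m th t) <= 4 * eta + 2 * (1 - trR (Lam t *m th t))
         + 4 * \sum_(t' | S t' && (t' != t)) trR (Lam t' *m th t)].
Proof.
move=> eL qth eta0; pose G := \sum_(t | S t) Lam t.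
have pL i : psd (Lam i) by case: (eL i).
have pG : psd G by apply: psd_sum => i _; exact: pL.
have [X [pX XGX hn]] := hayashi_nagaoka pG eta0.
have pI : psd (eta%:C%:M : 'M[C]_d).
  by rewrite -scalemx1; exact: psdZ (ltW eta0) (psd1 R d).
exists (fun t => X *m Lam t *m X); split.
- by move=> t; have := psd_conj X (pL t); rewrite (psd_herm pX).
- rewrite /loew -XGX -mulmx_suml -mulmx_sumr -/G mulmxDr mulmxDl addrAC subrr add0r.
  by have := psd_conj X pI; rewrite (psd_herm pX).
move=> t St; have pt : psd (th t) by case: (qth t).
have LG : loew (Lam t) (G + eta%:C%:M).
  apply: loew_trans (loew_sum_term St pL) _.
  by rewrite /loew -/G [G + _]addrC addrK; exact: pI.
have := hn _ _ (eL t) LG pt; rewrite (qstate_trR (qth t)).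
suff -> : trR ((G + eta%:C%:M - Lam t) *m th t)
   = eta + \sum_(t' | S t' && (t' != t)) trR (Lam t' *m th t).
  by move: (trR _) (trR _) (\sum_(_ | _) _) => *; lra.
rewrite addrAC /G (bigD1 t St) /= [Lam t + _]addrC addrK mulmxDl trRD addrC.
by rewrite -scalemx1 -scalemxAl mul1mx trRZ (qstate_trR (qth t)) mulr1 mulmx_suml trR_sum.
Qed.

Section BinError.
Variables (n d N L : nat) (p : 'I_n -> R) (th Lam : 'I_n -> 'M[C]_d) (eta : R).
Hypotheses (N0 : (0 < N)%N) (L0 : (0 < L)%N).
Hypotheses (hp : isdistr p) (qth : forall i, qstate (th i)).
Hypotheses (eL : forall i, effect (Lam i)) (eta0 : 0 < eta).

(** The bound of [bin_decoder] for [t] in its own bin; the bin is the second component of [h t], the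
    first being the hash value. *)
Definition bin_err (h : {ffun 'I_n -> 'I_N * 'I_L}) (t : 'I_n) : R :=
  4 * eta + 2 * (1 - trR (Lam t *m th t))
  + 4 * \sum_(t' | ((h t').2 == (h t).2) && (t' != t)) trR (Lam t' *m th t).

Lemma bin_err_ge0 h t : 0 <= bin_err h t.
Proof.
have pth i : psd (th i) by case: (qth i).
apply: addr_ge0; [apply: addr_ge0|]; apply: mulr_ge0 => //; first exact: ltW.
  by have /andP[_] := effect_trR (eL t) (pth t); rewrite (qstate_trR (qth t)) subr_ge0.
by apply: sumr_ge0 => t' _; apply: trR_psdM (pth t); case: (eL t').
Qed.

(** Distinct inputs share a bin with probability [1/L]. Summing the colliding tests over all pairs,
    with weights [p t], reassembles the average state and gives at most [b1]. *)
Lemma avg_bin_err (a1 b1 : R) :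
  \sum_i p i * (1 - trR (Lam i *m th i)) <= a1 ->
  \sum_i trR (Lam i *m \sum_j (p j)%:C *: th j) <= b1 ->
  avg (fun h => \sum_t p t * bin_err h t) <= 4 * eta + 2 * a1 + 4 * (b1 / L%:R).
Proof.
move=> h1 h2; have J0 := card_bins_gt0 N0 L0.
have pth i : psd (th i) by case: (qth i).
have -> : avg (fun h => \sum_t p t * bin_err h t)
  = 4 * eta + 2 * (\sum_i p i * (1 - trR (Lam i *m th i)))
  + 4 * (L%:R^-1 * \sum_t \sum_(t' | t' != t) p t * trR (Lam t' *m th t)).
  rewrite (@eq_avg _ _ _ (fun h : {ffun 'I_n -> 'I_N * 'I_L} =>
    (4 * eta + 2 * (\sum_i p i * (1 - trR (Lam i *m th i))))
    + 4 * \sum_t \sum_(t' | t' != t) (p t * trR (Lam t' *m th t)) * ((h t').2 == (h t).2)%:R)).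
    rewrite avgD (avg_cst _ J0) avgZ avg_sum; congr (_ + 4 * _).
    rewrite mulr_sumr; apply: eq_bigr => t _; rewrite avg_sum mulr_sumr.
    by apply: eq_bigr => t' ne; rewrite avgZ (avg_collision N0 L0 ne) mulrC.
  move=> h; have -> : 4 * eta = \sum_t p t * (4 * eta) by rewrite -mulr_suml (proj2 hp) mul1r.
  rewrite !mulr_sumr -!big_split /=; apply: eq_bigr => t _.
  rewrite /bin_err [p t * (_ + _ + _)]mulrDr [p t * (_ + _)]mulrDr; congr (_ + _ + _); first by rewrite mulrCA.
  rewrite mulrCA; congr (4 * _); rewrite mulr_sumr.
  rewrite (eq_bigl (fun t' => (t' != t) && ((h t').2 == (h t).2))) => [|t']; last by rewrite andbC.
  rewrite big_mkcondr /=; apply: eq_bigr => t' _.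
  by case: (_ == _); rewrite ?mulr1 ?mulr0.
apply: lerD; first by apply: lerD => //; rewrite ler_pM2l.
rewrite ler_pM2l // [b1 / _]mulrC ler_wpM2l ?invr_ge0 //.
apply: le_trans h2; rewrite (exchange_big_dep xpredT) //=; apply: ler_sum => t' _.
have -> : trR (Lam t' *m \sum_j (p j)%:C *: th j) = \sum_t p t * trR (Lam t' *m th t).
  by rewrite mulmx_sumr trR_sum; apply: eq_bigr => t _; rewrite -scalemxAr trRZ.
rewrite big_mkcond /=; apply: ler_sum => t _; case: ifP => // _.
by rewrite mulr_ge0 ?trR_psdM //; [case: hp|case: (eL t')].
Qed.
End BinError.
End Achievability.

(** * Achievability: public communication *)

Section PublicAchievability.
Variable R : realType.
Local Notation C := R[i].
Local Notation Rpart := (@complex.Re R).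

Lemma nat_between (x : R) : 1 <= x -> exists k : nat, [/\ (0 < k)%N, x <= k%:R & k%:R <= 2 * x].
Proof.
move=> x1; exists (Num.Def.truncn x).+1; split=> //; first exact: ltW (truncnS_gt x).
have x0 : 0 <= x by apply: le_trans x1.
have : (Num.Def.truncn x)%:R <= x by rewrite truncn_le.
by rewrite -natr1; lra.
Qed.

Lemma loew_sum_sub (I : finType) d (F : I -> 'M[C]_d) (A S : pred I) :
  (forall i, A i -> S i) -> (forall i, psd (F i)) ->
  loew (\sum_(i | A i) F i) (\sum_(i | S i) F i).
Proof.
move=> AS pF; rewrite /loew (bigID A S) /= (eq_bigl A) => [|i].
  by rewrite addrAC subrr add0r; apply: psd_sum => i _; exact: pF.
by case Ai: (A i); rewrite ?andbF // AS.
Qed.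

Lemma trR_diagM n (f : 'I_n -> R) (M : 'M[C]_n) :
  trR (diag_mx (\row_i (f i)%:C) *m M) = \sum_i f i * Rpart (M i i).
Proof. by rewrite trRE; apply: eq_bigr => i _; rewrite mul_diag_mx !mxE ReZ. Qed.

Lemma trR_diag n (f : 'I_n -> R) : trR (diag_mx (\row_i (f i)%:C) : 'M[C]_n) = \sum_i f i.
Proof. by rewrite trRE; apply: eq_bigr => i _; rewrite !mxE eqxx mulr1n. Qed.

Lemma psd_diag n (f : 'I_n -> R) : (forall i, 0 <= f i) -> psd (diag_mx (\row_i (f i)%:C) : 'M[C]_n).
Proof. by move=> f0; rewrite -spec_id; exact: spec_psd (unitary1 R n) _ f0. Qed.

Lemma qstate_diag n (p : 'I_n -> R) : isdistr p -> qstate (diag_mx (\row_i (p i)%:C) : 'M[C]_n).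
Proof.
move=> [p0 p1]; have pd := psd_diag p0.
by split; [exact: pd|rewrite (trR_mxtrace pd) trR_diag p1].
Qed.

(** Measure membership in [A]: the smoothed state gives it probability at most [#|A| lam], each
    diagonal entry being at most [lam], and smoothing changes it by at most [a]. *)
Lemma card_smooth_min n (p : 'I_n -> R) (rb : 'M[C]_n) (a lam : R) (A : {set 'I_n}) :
  isdistr p -> subnormalized rb -> pdist (diag_mx (\row_i (p i)%:C)) rb <= a ->
  loew rb (lam%:C *: 1%:M) -> \sum_(t in A) p t - a <= #|A|%:R * lam.
Proof.
move=> hp sb near rl.
have u1 := unitary1 R n.
have eA : effect (diag_mx (\row_i ((i \in A)%:R : R)%:C) : 'M[C]_n).
  rewrite -spec_id; split; first by apply: (spec_psd u1) => i; rewrite ler0n.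
  by apply: (spec_loew1 u1) => i; rewrite lern1 leq_b1.
have := pdist_meas (qstate_diag hp) sb near eA; rewrite !trR_diagM.
have -> : \sum_i (i \in A)%:R * Rpart ((diag_mx (\row_i0 (p i0)%:C) : 'M[C]_n) i i) = \sum_(t in A) p t.
  rewrite [RHS]big_mkcond /=; apply: eq_bigr => i _; rewrite !mxE eqxx mulr1n.
  by case: (i \in A); rewrite ?mul1r ?mul0r.
have : \sum_i (i \in A)%:R * Rpart (rb i i) <= #|A|%:R * lam.
  rewrite mulr_natl -sumr_const [leRHS]big_mkcond /=; apply: ler_sum => i _.
  have := psd_diag_ge0 1%:M i rl.
  rewrite adjm1 mulmx1 mul1mx !mxE eqxx ReD ReN mulr1 subr_ge0 => h.
  by case: (i \in A); rewrite ?mul1r ?mul0r.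
by move: (\sum_i _) (\sum_(_ in _) _) (#|A|%:R * lam) => x y z h; rewrite ler_norml => /andP[_]; lra.
Qed.

Lemma public_core n d (p : 'I_n -> R) (th : 'I_n -> 'M[C]_d)
    (rb1 : 'M[C]_n) (rb2 : 'M[C]_(n * d)) (eps lam mu : R) :
  0 < eps -> eps < 1 -> 0 < lam -> 0 < mu ->
  isdistr p -> (forall i, qstate (th i)) ->
  subnormalized rb1 -> pdist (diag_mx (\row_i (p i)%:C)) rb1 <= eps / 8 ->
  loew rb1 (lam%:C *: 1%:M) ->
  subnormalized rb2 -> pdist (bdiag (fun i => (p i)%:C *: th i)) rb2 <= eps / 8 ->
  (forall s : 'M[C]_d, qstate s -> fid rb2 (tensmx 1%:M s) <= Num.sqrt mu) ->
  exists k (enc : 'I_k -> 'I_n) (D : 'I_k -> 'M[C]_d),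
    [/\ (0 < k)%N, eps ^+ 4 / (2 ^+ 16 * lam * mu) <= k%:R, povm D &
        forall m, 1 - trR (D m *m th (enc m)) <= eps].
Proof.
move=> e0 e1 lam0 mu0 hp qth sb1 near1 rl sb2 near2 hfid.
have e'0 : 0 < eps / 16 by lra.
have [Lam [eL hL1 hL2]] := decoding_test hp qth sb2 mu0 e'0 near2 hfid.
have hmu := test_weight hp qth e'0 eL hL1 hL2.
have e20 : 0 < eps ^+ 2 by rewrite exprn_gt0.
have [L [L0 Lge Lle]] : exists L : nat,
   [/\ (0 < L)%N, 512 * mu / eps ^+ 2 <= L%:R & L%:R <= 2 * (512 * mu / eps ^+ 2)].
  apply: nat_between; rewrite ler_pdivlMr // mul1r expr2.
  by clear -e0 e1 hmu; nra.
have LR0 : 0 < L%:R :> R by rewrite ltr0n.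
have eta0 : 0 < eps / 128 by lra.
(* Public coding takes a one-element hash alphabet: only the bin matters. *)
have N0 : (0 < 1)%N by [].
have [h hh] := @ex_le_avg R _ _ (card_bins_gt0 N0 L0)
  (fun h : {ffun 'I_n -> 'I_1 * 'I_L} => \sum_t p t * bin_err th Lam (eps / 128) h t).
(* The three terms contribute [1/32], [12/32] and [4/32], in units of [eps]. *)
have {}hh : \sum_t p t * bin_err th Lam (eps / 128) h t <= 17 / 32 * eps.
  apply: le_trans hh (le_trans (avg_bin_err (eps / 128) N0 L0 hp qth eL hL1 hL2) _).
  suff : mu / (eps / 16) / L%:R <= eps / 32 by lra.
  rewrite ler_pdivrMr // ler_pdivrMr //.
  move: Lge; rewrite ler_pdivrMr // expr2; clear; nra.
pose Gd := finset (fun t => bin_err th Lam (eps / 128) h t <= eps).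
(* Markov's inequality: the inputs with bound above [eps] have mass at most [17/32]. *)
have pGd : 15 / 32 <= \sum_(t in Gd) p t.
  have : \sum_(t | t \notin Gd) p t * eps <= 17 / 32 * eps.
    apply: le_trans hh; rewrite [leRHS](bigID (mem Gd)) /= ler_wpDl //.
      by apply: sumr_ge0 => t _; rewrite mulr_ge0 ?(bin_err_ge0 qth eL eta0) //; case: hp.
    apply: ler_sum => t; rewrite finset.inE -ltNge => /ltW ht; rewrite ler_wpM2l //.
    by case: hp.
  rewrite -mulr_suml ler_pM2r //.
  have := proj2 hp; rewrite (bigID (mem Gd)) /=.
  by move=> *; lra.
have cGd := card_smooth_min Gd hp sb1 near1 rl.
pose A c := finset (fun t => (t \in Gd) && ((h t).2 == c)).
have [c hc] := @ex_le_mean R _ (fun _ : 'I_L => L%:R^-1) (fun c => - #|A c|%:R) (isdistr_unif R L0).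
have {}hc : #|Gd|%:R <= L%:R * #|A c|%:R :> R.
  move: hc; rewrite -mulr_sumr sumrN mulrN lerN2 -natr_sum.
  have -> : (\sum_c #|A c| = #|Gd|)%N.
    rewrite -sum1_card (partition_big (fun t => (h t).2) xpredT) //=.
    by apply: eq_bigr => c' _; rewrite -sum1_card; apply: eq_bigl => t; rewrite !finset.inE.
  by rewrite mulrC ler_pdivrMr // mulrC.
have kge : eps ^+ 4 / (2 ^+ 16 * lam * mu) <= #|A c|%:R.
  rewrite ler_pdivrMr; last by rewrite !mulr_gt0 // exprn_gt0.
  have h1 : 11 / 32 <= #|Gd|%:R * lam by lra.
  have h2 : #|Gd|%:R * lam <= (2 * (512 * mu / eps ^+ 2)) * #|A c|%:R * lam.
    by rewrite (ler_wpM2r (ltW lam0)) // (le_trans hc) // ler_wpM2r.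
  have h3 : 11 / 32 * eps ^+ 2 <= 1024 * mu * #|A c|%:R * lam.
    rewrite -ler_pdivlMr //; apply: le_trans h1 (le_trans h2 _).
    by rewrite le_eqVlt; apply/orP; left; apply/eqP; field; rewrite gt_eqF.
  (* The count obtained is of order [eps^2 / (lam mu)]; [eps < 1] weakens it to the form shared with
     the private bound. *)
  have h4 : eps ^+ 4 <= eps ^+ 2.
    by rewrite -[leRHS]mulr1 (exprD _ 2 2) ler_pM2l // expr2; clear -e0 e1; nra.
  have -> : #|A c|%:R * (2 ^+ 16 * lam * mu) = 64 * (1024 * mu * #|A c|%:R * lam) by ring.
  apply: le_trans h4 _; move: h3; move: (1024 * _ * _ * _) => w; clear -e20; lra.
have k0 : (0 < #|A c|)%N.
  rewrite -(ltr0n R); apply: lt_le_trans kge.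
  by rewrite divr_gt0 ?mulr_gt0 ?exprn_gt0.
(* The measurement is built from the whole bin, to which [bin_err] refers, and only then restricted
   to the good inputs. *)
have [D [pD D1 hD]] := bin_decoder (fun t => (h t).2 == c) eL qth eta0.
have D1' : loew (\sum_(m < #|A c|) D (enum_val m)) 1%:M.
  rewrite -big_enum_val; apply: loew_trans D1; apply: loew_sum_sub => // t.
  by rewrite !finset.inE => /andP[].
have [D' [pvD' hD']] := povm_complete k0 (fun m => pD (enum_val m)) D1'.
exists #|A c|, enum_val, D'; split=> // m.
have := enum_valP m; rewrite !finset.inE => /andP[ht /eqP htc].
apply: le_trans ht; have := hD (enum_val m); rewrite /bin_err htc eqxx => /(_ isT); apply: le_trans.
by rewrite lerD2l lerN2; apply: hD'; case: (qth (enum_val m)).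
Qed.
End PublicAchievability.

(** * Achievability: private communication *)

Section PrivateAchievability.
Variable R : realType.
Local Notation C := R[i].

(** Hoelder in a form without square roots: it is linear in the quadratic terms, so it can be
    averaged directly, without Jensen. *)
Lemma tnorm_amgm m n (r : R) (A : 'M[C]_(n, m)) (B : 'M[C]_(m, n)) : 0 < r ->
  tnorm (A *m B) <= (r * trR (A *m adjm A) + trR (adjm B *m B) / r) / 2.
Proof.
move=> r0; have [K [cK <-]] := tnorm_attain (A *m B); rewrite mulmxA.
apply: le_trans (trR_amgm _ _ r0) _; rewrite ler_pM2r // lerD2r ler_pM2l //.
rewrite adjmM mulmxA trRC !mulmxA -mulmxA.
have := loew_trR (contraction_adjm cK) (psd_gram A).
by rewrite adjmK mul1mx.
Qed.

Lemma tnorm_psd n (A : 'M[C]_n) : psd A -> tnorm A = trR A.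
Proof. by move=> pA; rewrite /tnorm (psd_herm pA) (sqrtm_uniq pA). Qed.

Lemma tnormZ_le n (a : R) (A : 'M[C]_n) : tnorm (a%:C *: A) <= `|a| * tnorm A.
Proof.
have [a0|a0] := leP 0 a; first by rewrite tnormZ // ger0_norm.
by rewrite -tnormN -scaleNr -(rmorphN (real_complex R)) /= ltr0_norm // tnormZ // oppr_ge0 ltW.
Qed.

(* [W = lam^-1/2 X sqrt z] satisfies [W W* = lam^-1 X z X <= 1], hence [W* W <= 1]. *)
Lemma weighted_hs n (z H X : 'M[C]_n) (lam : R) : 0 < lam -> psd z -> psd X ->
  X *m H *m X = 1%:M -> loew z (lam%:C *: H) ->
  trR (adjm (X *m z) *m (X *m z)) <= lam * trR z.
Proof.
move=> l0 pz pX XHX zH; have hX := psd_herm pX.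
have [S [hS eS]] : exists S, adjm S = S /\ S *m S = z.
  by exists (sqrtm z); split; [exact: sqrtm_herm|exact: sqrtmK].
have li0 : 0 <= lam^-1 by rewrite invr_ge0 ltW.
have e1 : X *m S *m adjm (X *m S) = X *m z *m X.
  by rewrite adjmM hS hX -eS !mulmxA.
have e2 : trR (adjm (X *m z) *m (X *m z)) = trR (adjm (X *m S) *m (X *m S) *m z).
  rewrite !adjmM hX hS (psd_herm pz) -eS.
  have -> : S *m S *m X *m (X *m (S *m S)) = S *m (S *m X *m X *m S *m S) by rewrite !mulmxA.
  by rewrite trRC !mulmxA.
have cW : contraction ((Num.sqrt lam^-1)%:C *: (X *m S)).
  rewrite /contraction adjmZ -scalemxAl -scalemxAr scalerA -rmorphM /= -expr2.
  rewrite (sqr_sqrtr li0) e1.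
  have := psdZ li0 (psd_conj X zH); rewrite hX mulmxBr mulmxBl scalerBr.
  rewrite -scalemxAr -scalemxAl XHX scalerA -rmorphM /= (mulVf (lt0r_neq0 l0)).
  by rewrite (rmorph1 (real_complex R)) scale1r.
have := loew_trR (contraction_adjm cW) pz; rewrite adjmK mul1mx.
rewrite adjmZ -scalemxAl -scalemxAr scalerA -rmorphM /= -expr2 (sqr_sqrtr li0).
by rewrite -scalemxAl trRZ -e2 mulrC ler_pdivrMr // mulrC.
Qed.

(** * Leftover hashing against quantum side information *)

Section LeftoverHash.
Variables (n d : nat) (J : finType) (z : 'I_n -> 'M[C]_d) (H X : 'M[C]_d) (lam r : R).
Hypotheses (J0 : (0 < #|J|)%N) (pz : forall t, psd (z t)) (lam0 : 0 < lam) (r0 : 0 < r).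
Hypotheses (pH : psd H) (pX : psd X) (XHX : X *m H *m X = 1%:M).
Hypothesis zH : forall t, loew (z t) (lam%:C *: H).

Let K : R := #|J|%:R.
Let K0 : 0 < K. Proof. by rewrite ltr0n. Qed.
Let Ki0 : 0 <= K^-1. Proof. by rewrite invr_ge0 ltW. Qed.
Let c (h : {ffun 'I_n -> J}) j t : R := (h t == j)%:R - K^-1.
Let ip t t' := trR (adjm (X *m z t) *m (X *m z t')).

Let dev_eq (h : {ffun 'I_n -> J}) j :
  \sum_(t | h t == j) z t - (K^-1)%:C *: \sum_t z t = \sum_t (c h j t)%:C *: z t.
Proof.
rewrite big_mkcond /= scaler_sumr -sumrB; apply: eq_bigr => t _.
rewrite /c rmorphB scalerBl; congr (_ - _).
by case: (h t == j); rewrite ?(rmorph1 (real_complex R)) ?(rmorph0 (real_complex R)) ?scale1r ?scale0r.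
Qed.

Let tnorm_dev (h : {ffun 'I_n -> J}) j :
  tnorm (\sum_(t | h t == j) z t - (K^-1)%:C *: \sum_t z t)
  <= (r * trR H + (\sum_t \sum_t' (c h j t * c h j t') * ip t t') / r) / 2.
Proof.
rewrite dev_eq; move: (erefl (\sum_t (c h j t)%:C *: z t)).
move: {1 3}(\sum_t (c h j t)%:C *: z t) => A eA.
(* [X] acts as the inverse root of [H]. Factoring [A = (H X) (X A)] gives [tr (H X) (H X)* = tr H]
   and leaves a weighted second moment of [A]. *)
have HXX : H *m X *m X = 1%:M by apply: mulmx1C; rewrite mulmxA.
rewrite -[A in tnorm A]mul1mx -HXX -mulmxA.
apply: le_trans (tnorm_amgm _ _ r0) _.
rewrite (_ : trR (H *m X *m adjm (H *m X)) = trR H); last first.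
  by rewrite adjmM (psd_herm pH) (psd_herm pX) mulmxA HXX mul1mx.
rewrite (_ : trR (adjm (X *m A) *m (X *m A)) = \sum_t \sum_t' (c h j t * c h j t') * ip t t') //.
have XA : X *m A = \sum_t (c h j t)%:C *: (X *m z t).
  by rewrite eA mulmx_sumr; apply: eq_bigr => t _; rewrite -scalemxAr.
rewrite XA adjm_sum mulmx_suml trR_sum; apply: eq_bigr => t _.
rewrite mulmx_sumr trR_sum; apply: eq_bigr => t' _.
by rewrite adjmZ -scalemxAl -scalemxAr !trRZ mulrA.
Qed.

Let sum_dev j : \sum_(j' : J) (((j' == j)%:R : R) - K^-1) = 0.
Proof.
rewrite sumrB (bigD1 j) //= eqxx big1 => [|j' /negPf -> //].
have -> : \sum_(i : J) K^-1 = 1.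
  by rewrite sumr_const -[LHS]mulr_natl divff // gt_eqF.
by rewrite addr0 subrr.
Qed.

Let avg_c0 j t t' : t != t' -> avg (fun h => c h j t * c h j t') = 0.
Proof.
move=> ne; rewrite (avg2 J0 (fun j' => (j' == j)%:R - K^-1) (fun j' => (j' == j)%:R - K^-1) ne).
by rewrite sum_dev mulr0 mul0r.
Qed.

Let avg_c1 j t : avg (fun h => c h j t * c h j t) <= K^-1.
Proof.
rewrite (avg1 J0 (fun j' => ((j' == j)%:R - K^-1) * ((j' == j)%:R - K^-1))).
rewrite -[leRHS]mulr1 (ler_wpM2l Ki0) //.
have -> : \sum_j' (((j' == j)%:R : R) - K^-1) * ((j' == j)%:R - K^-1)
  = \sum_j' (j' == j)%:R * (((j' == j)%:R : R) - K^-1) - K^-1 * (\sum_j' (((j' == j)%:R : R) - K^-1)).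
  by rewrite mulr_sumr -sumrB; apply: eq_bigr => j' _; rewrite mulrBl.
rewrite sum_dev mulr0 subr0 (bigD1 j) //= eqxx big1 => [|j' /negPf ->]; last by rewrite mul0r.
by rewrite addr0 mul1r gerBl.
Qed.

(** The coefficients [c h j t] are centred and pairwise independent, so only diagonal terms survive
    averaging. Each has variance at most [1/K], and [weighted_hs] bounds the accompanying norm by
    [lam tr (z t)]. *)
Lemma leftover_hash :
  avg (fun h : {ffun 'I_n -> J} =>
    \sum_j tnorm (\sum_(t | h t == j) z t - (K^-1)%:C *: \sum_t z t))
  <= (r * K * trR H + lam * (\sum_t trR (z t)) / r) / 2.
Proof.
apply: (@le_trans _ _ (avg (fun h : {ffun 'I_n -> J} =>
   \sum_j (r * trR H + (\sum_t \sum_t' (c h j t * c h j t') * ip t t') / r) / 2))).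
  by apply: (avg_le J0) => h; apply: ler_sum => j _; exact: tnorm_dev.
rewrite avg_sum.
apply: (@le_trans _ _ (\sum_(j : J) (r * trR H + (K^-1 * (lam * \sum_t trR (z t))) / r) / 2)).
  apply: ler_sum => j _.
  rewrite (@eq_avg _ _ _ _ (fun h : {ffun 'I_n -> J} => r * trR H / 2
     + (r^-1 / 2) * \sum_t \sum_t' ip t t' * (c h j t * c h j t'))); last first.
    move=> h; rewrite (_ : \sum_t \sum_t' _ = \sum_t \sum_t' ip t t' * (c h j t * c h j t')).
      by ring.
    by apply: eq_bigr => t _; apply: eq_bigr => t' _; rewrite mulrC.
  rewrite avgD (avg_cst _ J0) avgZ.
  have -> : (r * trR H + K^-1 * (lam * (\sum_t trR (z t))) / r) / 2
    = r * trR H / 2 + (r^-1 / 2) * (K^-1 * (lam * (\sum_t trR (z t)))) by ring.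
  rewrite lerD2l; apply: ler_wpM2l; first by rewrite divr_ge0 // invr_ge0 ltW.
  rewrite avg_sum 2!mulr_sumr; apply: ler_sum => t _; rewrite avg_sum (bigD1 t) //= avgZ.
  rewrite [X in _ + X]big1 => [|t' ne]; last by rewrite avgZ avg_c0 ?mulr0 // eq_sym.
  rewrite addr0 mulrC; apply: ler_pM => //.
  - rewrite (avg1 J0 (fun j' => ((j' == j)%:R - K^-1) * ((j' == j)%:R - K^-1))).
    by rewrite mulr_ge0 // sumr_ge0 // => j' _; rewrite -expr2 sqr_ge0.
  - by have := hsE (adjm (X *m z t)); rewrite adjmK.
  exact: weighted_hs (zH t).
rewrite sumr_const -[_ *+ _]mulr_natl -/K.
rewrite le_eqVlt; apply/orP; left; apply/eqP; field.
by rewrite !gt_eqF.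
Qed.
End LeftoverHash.

(** The optimal tests of all blocks form one block-diagonal effect, so a single use of [pdist_meas]
    bounds the whole sum; only the diagonal blocks of [rb] occur. *)
Lemma smooth_blocks n d (p : 'I_n -> R) (z : 'I_n -> 'M[C]_d) (rb : 'M[C]_(n * d)) (a : R) :
  isdistr p -> (forall t, qstate (z t)) -> subnormalized rb ->
  pdist (bdiag (fun t => (p t)%:C *: z t)) rb <= a ->
  \sum_t tnorm ((p t)%:C *: z t - bget t rb) <= 2 * a.
Proof.
move=> hp qz sb near; have qpsi := qstate_bdiag hp qz; have [prb trb] := sb.
have herm t : adjm ((p t)%:C *: z t - bget t rb) = (p t)%:C *: z t - bget t rb.
  by rewrite adjmB adjmZ (psd_herm (proj1 (qz t))) (psd_herm (psd_bget t prb)).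
have /choice[L hL] : forall t, exists L, effect L /\
   tnorm ((p t)%:C *: z t - bget t rb) = 2 * trR (L *m ((p t)%:C *: z t - bget t rb))
     - trR ((p t)%:C *: z t - bget t rb) by move=> t; exact: herm_tnorm.
have eL : effect (bdiag L) by apply: effect_bdiag => t; case: (hL t).
have := pdist_meas qpsi sb near eL; rewrite !trR_bdiagM => /(le_trans (ler_norm _)) h.
have h1 : trR rb = \sum_t trR (bget t rb).
  rewrite -[rb in LHS]mul1mx -bdiag1 trR_bdiagM; apply: eq_bigr => t _.
  by rewrite mul1mx.
have h2 : \sum_t trR ((p t)%:C *: z t) = 1 by rewrite -trR_bdiag qstate_trR.
rewrite (eq_bigr _ (fun t _ => proj2 (hL t))) sumrB -mulr_sumr.
under eq_bigr do rewrite mulmxBr trRB.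
under [X in _ - X <= _]eq_bigr do rewrite trRB.
rewrite !sumrB h2 -h1.
move: h; rewrite (eq_bigr (fun i => trR (L i *m ((p i)%:C *: z i)))) => [|i _].
  by move: trb; lra.
by rewrite bget_bdiag.
Qed.

Section PrivateCode.
Variables (n dY dZ : nat) (p : 'I_n -> R).
Variables (y : 'I_n -> 'M[C]_dY) (z : 'I_n -> 'M[C]_dZ) (Lam : 'I_n -> 'M[C]_dY).
Hypotheses (hp : isdistr p) (qy : forall t, qstate (y t)) (qz : forall t, qstate (z t)).
Hypothesis eL : forall t, effect (Lam t).

Let zb := \sum_t (p t)%:C *: z t.

Section Hash.
Variables (N L : nat) (N0 : (0 < N)%N) (L0 : (0 < L)%N).
Local Notation J := ('I_N * 'I_L)%type.
Variables (rb : 'M[C]_(n * dZ)) (s : 'M[C]_dZ) (eps lam mu : R).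
Hypotheses (e0 : 0 < eps) (lam0 : 0 < lam) (mu0 : 0 < mu).
Hypotheses (sb : subnormalized rb) (near : pdist (bdiag (fun t => (p t)%:C *: z t)) rb <= eps / 8).
Hypotheses (qs : qstate s) (rl : loew rb (lam%:C *: tensmx (1%:M : 'M[C]_n) s)).
Hypothesis hL1 : \sum_i p i * (1 - trR (Lam i *m y i)) <= eps / 8 + eps / 8.
Hypothesis hL2 : \sum_i trR (Lam i *m \sum_j (p j)%:C *: y j) <= mu / (eps / 8).
Hypothesis Lge : 256 * mu / eps ^+ 2 <= L%:R.
Hypothesis Kle : (N * L)%:R * lam <= eps ^+ 2 / 32.

Let K : R := #|{: J}|%:R.
Let eK : K = (N * L)%:R. Proof. by rewrite /K card_prod !card_ord. Qed.
Let K0 : 0 < K. Proof. by rewrite eK ltr0n muln_gt0 N0. Qed.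
Let zt t := bget t rb.

Let avg_smooth : avg (fun h : {ffun 'I_n -> J} =>
    \sum_j tnorm (\sum_(t | h t == j) zt t - (K^-1)%:C *: \sum_t zt t)) <= eps / 4.
Proof.
have ps : psd s by case: qs.
have d0 : 0 < dZ%:R :> R.
  rewrite ltr0n lt0n; apply/negP => /eqP dz; have := qstate_trR qs.
  by rewrite trRE big1 => [/eqP|[i hi]]; [rewrite eq_sym oner_eq0|exfalso; move: hi; rewrite dz].
have di0 : 0 < dZ%:R^-1 :> R by rewrite invr_gt0.
have [X [pX XHX _]] := hayashi_nagaoka ps di0.
set H := s + _ in XHX.
(* [s] may be singular. Adding the maximally mixed state makes [H] invertible with trace 2, whatever
   the dimension; [hayashi_nagaoka] is used here only for the inverse root. *)
have eH : H = s + (dZ%:R^-1)%:C *: 1%:M by rewrite /H scalemx1.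
have pI : psd ((dZ%:R^-1 : R)%:C *: (1%:M : 'M[C]_dZ)) by exact: psdZ (ltW di0) (psd1 R dZ).
have pH : psd H by rewrite eH; exact: psdD.
have tH : trR H = 2 by rewrite eH trRD trRZ trR1 (qstate_trR qs) mulVf ?gt_eqF //.
have zH t : loew (zt t) (lam%:C *: H).
  apply: loew_trans (loew_bget t rl) _; rewrite tensmx1l bdiagZ bget_bdiag.
  rewrite /loew eH scalerDr addrAC subrr add0r.
  exact: psdZ (ltW lam0) pI.
have prb : psd rb by case: sb.
(* With this [r], the term [r K tr H] equals [eps / 4], and [Kle] makes [lam / r] at most
   [eps / 4]. *)
have r0 : 0 < eps / (8 * K) by rewrite divr_gt0 // mulr_gt0.
apply: le_trans (leftover_hash (card_bins_gt0 N0 L0) (fun t => psd_bget t prb) lam0 r0 pH pX XHX zH) _.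
have h1 : \sum_t trR (zt t) <= 1.
  case: sb => _; apply: le_trans; rewrite -[rb in leRHS]mul1mx -bdiag1 trR_bdiagM.
  by apply: ler_sum => t _; rewrite mul1mx.
rewrite tH -/K.
have -> : eps / (8 * K) * K * 2 = eps / 4 by field; rewrite gt_eqF.
have h2 : lam * (\sum_t trR (zt t)) / (eps / (8 * K)) <= eps / 4.
  rewrite ler_pdivrMr //.
  have -> : eps / 4 * (eps / (8 * K)) = eps ^+ 2 / 32 / K by field; rewrite gt_eqF.
  rewrite ler_pdivlMr //; apply: le_trans Kle; rewrite -eK [leRHS]mulrC ler_wpM2r ?(ltW K0) //.
  by rewrite -[leRHS]mulr1 ler_wpM2l // ltW.
lra.
Qed.

Lemma private_hash : exists h : {ffun 'I_n -> J},
  \sum_j tnorm (\sum_(t | h t == j) (p t)%:C *: z t - (K^-1)%:C *: zb)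
  + \sum_t p t * bin_err y Lam (eps / 32) h t <= 3 / 2 * eps.
Proof.
have J0 := card_bins_gt0 N0 L0.
have [h hh] := @ex_le_avg R _ _ J0 (fun h : {ffun 'I_n -> J} =>
  \sum_j tnorm (\sum_(t | h t == j) (p t)%:C *: z t - (K^-1)%:C *: zb)
  + \sum_t p t * bin_err y Lam (eps / 32) h t).
exists h; apply: le_trans hh _; rewrite avgD.
have h1 : avg (fun h : {ffun 'I_n -> J} => \sum_t p t * bin_err y Lam (eps / 32) h t) <= 3 / 4 * eps.
  apply: le_trans (avg_bin_err (eps / 32) N0 L0 hp qy eL hL1 hL2) _.
  suff : mu / (eps / 8) / L%:R <= eps / 32 by lra.
  rewrite ler_pdivrMr ?ltr0n // ler_pdivrMr ?divr_gt0 //.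
  have he0 := e0; have hmu0 := mu0; move: Lge; rewrite ler_pdivrMr ?exprn_gt0 // expr2; nra.
suff : avg (fun h : {ffun 'I_n -> J} =>
   \sum_j tnorm (\sum_(t | h t == j) (p t)%:C *: z t - (K^-1)%:C *: zb)) <= 3 / 4 * eps by lra.
pose dl t := (p t)%:C *: z t - zt t.
have hd : \sum_t tnorm (dl t) <= 2 * (eps / 8) by exact: smooth_blocks.
apply: (@le_trans _ _ (avg (fun h : {ffun 'I_n -> J} =>
    \sum_j tnorm (\sum_(t | h t == j) zt t - (K^-1)%:C *: \sum_t zt t) + 4 * (eps / 8)))); last first.
  by rewrite avgD (avg_cst _ J0); have := avg_smooth; lra.
apply: (avg_le J0) => {}h.
(* The smoothing error is paid twice: within the cells of the hash and in the uniform average. *)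
have -> : 4 * (eps / 8) = 2 * (eps / 8) + 2 * (eps / 8) by lra.
apply: (@le_trans _ _ (\sum_j (tnorm (\sum_(t | h t == j) zt t - (K^-1)%:C *: \sum_t zt t)
   + (\sum_(t | h t == j) tnorm (dl t) + K^-1 * \sum_t tnorm (dl t))))).
  apply: ler_sum => j _.
  have -> : \sum_(t | h t == j) (p t)%:C *: z t - (K^-1)%:C *: zb =
    (\sum_(t | h t == j) zt t - (K^-1)%:C *: \sum_t zt t)
    + (\sum_(t | h t == j) dl t + (- ((K^-1)%:C *: \sum_t dl t))).
    rewrite /dl /zb !sumrB scalerBr.
    move: (\sum_(t | _) _) (\sum_(t | _) _) (_ *: _) (_ *: _) => A B D E.
    by apply/matrixP => a b; rewrite !mxE; ring.
  apply: le_trans (tnormD _ _) _; rewrite lerD2l.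
  apply: le_trans (tnormD _ _) _; apply: lerD; first exact: tnorm_sum.
  by rewrite tnormN tnormZ ?invr_ge0 ?(ltW K0) // ler_wpM2l ?invr_ge0 ?(ltW K0) //; exact: tnorm_sum.
rewrite big_split lerD2l big_split /= sum_fibers; apply: lerD => //.
rewrite -mulr_suml (_ : \sum_(j : J) K^-1 = 1) ?mul1r //.
by rewrite sumr_const -[LHS]mulr_natl divff // gt_eqF.
Qed.
End Hash.

(** * Extraction of a private code from a good hash function *)

Section Extract.
Variables (k L : nat) (eps : R).
Hypotheses (k0 : (0 < k)%N) (L0 : (0 < L)%N) (e0 : 0 < eps) (e1 : eps < 1 / 8).
Local Notation J := ('I_(2 * k) * 'I_L)%type.
Variable h : {ffun 'I_n -> J}.
Let K : R := #|{: J}|%:R.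
Let u t := bin_err y Lam (eps / 32) h t.
Let zj j := \sum_(t | h t == j) (p t)%:C *: z t.
Hypothesis hh : \sum_j tnorm (zj j - (K^-1)%:C *: zb) + \sum_t p t * u t <= 3 / 2 * eps.

Let N0 : (0 < 2 * k)%N. Proof. by rewrite muln_gt0. Qed.
Let eK : K = 2 * k%:R * L%:R. Proof. by rewrite /K card_prod !card_ord !natrM. Qed.
Let kR0 : 0 < k%:R :> R. Proof. by rewrite ltr0n. Qed.
Let LR0 : 0 < L%:R :> R. Proof. by rewrite ltr0n. Qed.
Let K0 : 0 < K. Proof. by rewrite eK !mulr_gt0. Qed.
Let p0 t : 0 <= p t. Proof. by case: hp. Qed.
Let eta0 : 0 < eps / 32. Proof. by rewrite divr_gt0. Qed.
Let u0 t : 0 <= u t. Proof. exact: (bin_err_ge0 qy eL eta0 h t). Qed.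

Let a c m := tnorm (zj (m, c) - (K^-1)%:C *: zb) + \sum_(t | h t == (m, c)) p t * u t.
Let a0 c m : 0 <= a c m.
Proof. by rewrite addr_ge0 ?tnorm_ge0 ?sumr_ge0 // => t _; rewrite mulr_ge0. Qed.

(** Some bin has at most the average total cost. There the mean of [K * a c m] over the [2 k]
    messages is at most [3/2 eps], so by Markov's inequality at most [k] of them exceed [3 eps]. *)
Let ex_good : exists c, (k <= #|finset (fun m => (K * a c m <= 3 * eps)%R)|)%N.
Proof.
have [c hc] := @ex_le_mean R _ (fun _ : 'I_L => L%:R^-1) (fun c => \sum_m a c m) (isdistr_unif R L0).
exists c; set A := finset _.
have tot : \sum_c \sum_m a c m <= 3 / 2 * eps.
  apply: le_trans hh; rewrite le_eqVlt; apply/orP; left; apply/eqP.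
  rewrite exchange_big pair_bigA /= big_split /=; congr (_ + _).
  rewrite -(sum_fibers h (fun t => p t * u t)); by apply: eq_bigr => -[m c'] _.
have hc2 : L%:R * \sum_m a c m <= 3 / 2 * eps.
  apply: le_trans tot; move: hc; rewrite -mulr_sumr.
  by rewrite ler_pdivlMl.
have cA : #|finset.setC A|%:R * (3 * eps) <= k%:R * (3 * eps).
  apply: (@le_trans _ _ (K * \sum_m a c m)); last first.
    rewrite eK -mulrA; apply: (@le_trans _ _ (2 * k%:R * (3 / 2 * eps))).
      by rewrite ler_wpM2l // mulr_ge0.
    by lra.
  rewrite mulr_sumr (bigID (mem A)) /= ler_wpDl //.
    by apply: sumr_ge0 => m _; rewrite mulr_ge0 ?(ltW K0).
  rewrite mulr_natl -sumr_const; rewrite (eq_bigl (fun m => m \notin A)) => [|m]; last by rewrite finset.inE.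
  by apply: ler_sum => m; rewrite finset.inE -ltNge => /ltW.
have : (#|finset.setC A| <= k)%N by rewrite -(ler_nat R) -(ler_pM2r (_ : 0 < 3 * eps)) // mulr_gt0.
have cc : (#|A| + #|finset.setC A| = k + k)%N by rewrite cardsC card_ord mul2n addnn.
by move=> cle; rewrite -(leq_add2r #|finset.setC A|) cc leq_add2l.
Qed.

Lemma private_extract : exists k' (q : 'I_k' -> 'I_n -> R) (D : 'I_k' -> 'M[C]_dY),
  [/\ (k <= k')%N, forall m, isdistr (q m), povm D,
     forall m, 1 - \sum_t q m t * trR (D m *m y t) <= 8 * eps &
     forall m, tnorm (\sum_t (q m t)%:C *: z t
         - (k'%:R^-1 : R)%:C *: \sum_m' \sum_t (q m' t)%:C *: z t) / 2 <= 8 * eps].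
Proof.
have he0 := e0; have he1 := e1; have [c] := ex_good; set A := finset _ => kA.
have A0 : (0 < #|A|)%N by exact: leq_trans kA.
pose msg (i : 'I_#|A|) : 'I_(2 * k) := enum_val i.
have good i : K * a c (msg i) <= 3 * eps by have := enum_valP i; rewrite finset.inE.
pose Pm i := \sum_(t | h t == (msg i, c)) p t.
have qzb : qstate zb by exact: qstate_mix.
have psdz t : psd (z t) by case: (qz t).
have psdy t : psd (y t) by case: (qy t).
have trzj i : trR (zj (msg i, c)) = Pm i.
  by rewrite trR_sum; apply: eq_bigr => t _; rewrite trRZ (qstate_trR (qz t)) mulr1.
have pu0 i : 0 <= \sum_(t | h t == (msg i, c)) p t * u t.
  by apply: sumr_ge0 => t _; rewrite mulr_ge0.
have tn i : K * tnorm (zj (msg i, c) - (K^-1)%:C *: zb) <= 3 * eps.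
  by apply: le_trans (good i); rewrite ler_wpM2l ?(ltW K0) // lerDl.
have pu i : K * \sum_(t | h t == (msg i, c)) p t * u t <= 3 * eps.
  by apply: le_trans (good i); rewrite ler_wpM2l ?(ltW K0) // lerDr tnorm_ge0.
(* The trace norm controls the trace: near-uniformity of the cell state also fixes its probability
   near [1/K]. *)
have KP i : `|K * Pm i - 1| <= 3 * eps.
  apply: le_trans (tn i).
  have -> : K * Pm i - 1 = K * (Pm i - K^-1) by rewrite mulrBr mulfV ?gt_eqF.
  rewrite normrM (gtr0_norm K0) ler_wpM2l ?(ltW K0) //.
  have := norm_trR_tnorm (zj (msg i, c) - (K^-1)%:C *: zb).
  by rewrite trRB trRZ trzj (qstate_trR qzb) mulr1.
(* From [3 eps < 3/8]; conditioning on a cell is therefore well defined and costs a bounded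
   factor. *)
have KP5 i : 5 / 8 <= K * Pm i by have := KP i; rewrite ler_norml => /andP[? ?]; lra.
have Pm0 i : 0 < Pm i by rewrite -(pmulr_rgt0 _ K0); have := KP5 i; lra.
pose q i t := if h t == (msg i, c) then p t / Pm i else 0.
have hq i : isdistr (q i).
  split=> [t|]; first by rewrite /q; case: ifP => // _; rewrite divr_ge0 ?(ltW (Pm0 i)).
  by rewrite -big_mkcond -mulr_suml -/(Pm i) divff // gt_eqF.
have [D0 [pD0 D01 hD0]] := bin_decoder (fun t => (h t).2 == c) eL qy eta0.
pose D i := \sum_(t | h t == (msg i, c)) D0 t.
have pD i : psd (D i) by apply: psd_sum => t _; exact: pD0.
have D1 : loew (\sum_i D i) 1%:M.
  apply: loew_trans D01; rewrite /D /msg -(big_enum_val (fun m => \sum_(t | h t == (m, c)) D0 t)).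
  have -> : \sum_(t | (h t).2 == c) D0 t = \sum_m \sum_(t | h t == (m, c)) D0 t.
    rewrite (partition_big (fun t => (h t).1) xpredT) //=; apply: eq_bigr => m _.
    by apply: eq_bigl => t; rewrite andbC; case: (h t) => m' c'; rewrite xpair_eqE.
  apply: (loew_sum_sub (F := fun m => \sum_(t | h t == (m, c)) D0 t)) => // m.
  by apply: psd_sum => t _; exact: pD0.
have [D' [povmD' hD']] := povm_complete A0 pD D1.
pose b i := \sum_t (q i t)%:C *: z t.
have qb i : qstate (b i) by exact: qstate_mix.
have eb i : (Pm i)%:C *: b i = zj (msg i, c).
  rewrite scaler_sumr /zj [RHS]big_mkcond; apply: eq_bigr => t _ /=.
  rewrite /q; case: ifP => _; last by rewrite (rmorph0 (real_complex R)) scale0r scaler0.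
  by rewrite scalerA -rmorphM /= mulrC divfK // gt_eqF.
have bz i : tnorm (b i - zb) <= 6 * eps.
  (* One term is the deviation of the unnormalized cell state, the other its normalization error;
     each costs [3 eps]. *)
  have -> : b i - zb = K%:C *: (zj (msg i, c) - (K^-1)%:C *: zb) + (1 - K * Pm i)%:C *: b i.
    rewrite scalerBr scalerA -rmorphM /= mulfV ?gt_eqF // (rmorph1 (real_complex R)) scale1r.
    rewrite rmorphB scalerBl (rmorph1 (real_complex R)) scale1r rmorphM -scalerA eb.
    by rewrite [RHS]addrC addrA subrK.
  apply: le_trans (tnormD _ _) _; rewrite tnormZ ?(ltW K0) //.
  have := tnormZ_le (1 - K * Pm i) (b i).
  rewrite (tnorm_psd (proj1 (qb i))) (qstate_trR (qb i)) mulr1 distrC.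
  by have := tn i; have := KP i; move: (tnorm _) (tnorm _) (`|_|) => *; lra.
(* The decoding error is at most [3 eps / (5/8)]. Secrecy compares with the mean of the retained
   messages instead of [zb], costing [6 eps] twice before halving. Both results are below
   [8 eps]. *)
exists #|A|, q, D'; split=> // i.
  have -> : 1 - \sum_t q i t * trR (D' i *m y t) = \sum_t q i t * (1 - trR (D' i *m y t)).
    under [RHS]eq_bigr do rewrite mulrBr mulr1.
    by rewrite sumrB (proj2 (hq i)).
  apply: (@le_trans _ _ ((\sum_(t | h t == (msg i, c)) p t * u t) / Pm i)).
    rewrite mulr_suml [leRHS]big_mkcond; apply: ler_sum => t _ /=.
    rewrite /q; case: eqP => ht; last by rewrite mul0r.
    rewrite mulrAC; apply: ler_wpM2r; first by rewrite invr_ge0 ltW.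
    apply: (ler_wpM2l (p0 t)).
    have htc : (h t).2 == c by rewrite ht.
    have := hD0 t htc; rewrite -{1}(eqP htc); apply: le_trans.
    rewrite lerD2l lerN2; apply: le_trans (hD' i _ (psdy t)).
    apply: loew_trR (psdy t).
    by apply: (loew_sum_term (F := D0)) => //; apply/eqP.
  rewrite ler_pdivrMr // -(ler_pM2l K0) mulrCA; apply: le_trans (pu i) _.
  by have := KP5 i; move: (K * Pm i) => w; nra.
rewrite ler_pdivrMr //.
have kA0 : 0 < #|A|%:R :> R by rewrite ltr0n.
have -> : b i - (#|A|%:R^-1)%:C *: \sum_m' b m'
  = (b i - zb) + (#|A|%:R^-1)%:C *: \sum_m' (zb - b m').
  rewrite sumrB scalerBr sumr_const -scaler_nat scalerA card_ord.
  rewrite -(rmorph_nat (real_complex R)) -rmorphM /= mulVf ?gt_eqF //.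
  by rewrite (rmorph1 (real_complex R)) scale1r addrA subrK.
apply: le_trans (tnormD _ _) _.
have h2 : tnorm ((#|A|%:R^-1)%:C *: \sum_m' (zb - b m')) <= 6 * eps.
  rewrite tnormZ ?invr_ge0 ?(ltW kA0) // mulrC ler_pdivrMr //.
  apply: le_trans (tnorm_sum _ _ _) _.
  apply: (@le_trans _ _ (\sum_(m' < #|A|) 6 * eps)).
    by apply: ler_sum => m' _; rewrite tnormB.
  by rewrite sumr_const card_ord -[_ *+ _]mulr_natr.
by have := bz i; move: h2; move: (tnorm _) (tnorm _) => *; lra.
Qed.
End Extract.
End PrivateCode.
End PrivateAchievability.

(** * From one-shot estimates to capacities *)

Section Main.
Variable R : realType.
Local Notation C := R[i].

Lemma lg2M (x y : R) : 0 < x -> 0 < y -> lg2 (x * y) = lg2 x + lg2 y.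
Proof. by move=> x0 y0; rewrite /lg2 lnM ?posrE // mulrDl. Qed.

Lemma lg2X (x : R) n : 0 < x -> lg2 (x ^+ n) = n%:R * lg2 x.
Proof. by move=> x0; rewrite /lg2 lnXn // -[ln x *+ n]mulr_natl mulrA. Qed.

Lemma lg2_2 : lg2 (2 : R) = 1.
Proof. by rewrite /lg2 divff // gt_eqF // ln2_gt0. Qed.

Lemma lg2_exp (x : R) : lg2 (powR 2 x) = x.
Proof. by rewrite /lg2 ln_powR mulfK // gt_eqF // ln2_gt0. Qed.

Lemma lg2_le_inv (x y : R) : 0 < x -> 0 < y -> lg2 x <= lg2 y -> x <= y.
Proof. by move=> x0 y0; rewrite /lg2 ler_pM2r ?invr_gt0 ?ln2_gt0 // ler_ln ?posrE. Qed.

Lemma ereal_sub_gt (a b : \bar R) (v : R) : (v%:E < a - b)%E ->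
  exists x y : R, [/\ (x%:E < a)%E, (b < y%:E)%E & v < x - y].
Proof.
case: a => [r| |]; case: b => [s| |] //=; rewrite ?lte_fin => h.
- by exists (r - (r - s - v) / 3), (s + (r - s - v) / 3); rewrite !lte_fin; split=> //; lra.
- clear h; exists (r - 1), (r - 1 - v - 1); rewrite lte_fin ltNyr; split=> //; lra.
- clear h; exists (v + (s + 1) + 1), (s + 1); rewrite lte_fin ltry; split=> //; lra.
clear h; exists (v + 1), 0; rewrite ltry ltNyr; split=> //; lra.
Qed.

Lemma elg2_inf_lt (w : \bar R) (x : R) : (x%:E < - elg2 w)%E -> (w < (powR 2 (- x))%:E)%E.
Proof.
move=> h; rewrite ltNge; apply/negP => hw; move: h; apply/negP; rewrite -leNgt.
have e0 : 0 < powR 2 (- x) by exact: powR_gt0.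
rewrite leeNl -EFinN -(lg2_exp (- x)).
case: w hw => [w| |] //=; rewrite ?leey // lee_fin => hw.
case: (leP w 0) => [w0|_]; last by rewrite lee_fin lg2_ler.
by have := lt_le_trans e0 (le_trans hw w0); rewrite ltxx.
Qed.

Lemma Hmax_lt_fid dA dB (rb : 'M[C]_(dA * dB)) (y : R) : (Hmax rb < y%:E)%E ->
  forall s : 'M[C]_dB, qstate s -> fid rb (tensmx 1%:M s) <= Num.sqrt (powR 2 y).
Proof.
move=> hy s qs; set F := fid _ _.
have [F0|F0] := leP F 0; first by apply: le_trans F0 (sqrtr_ge0 _).
have : (2%:E * elg2 F%:E <= Hmax rb)%E by apply: ereal_sup_ubound; exists s.
move=> /le_lt_trans/(_ hy); rewrite /= leNgt F0 /= -EFinM lte_fin => h.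
rewrite -(ger0_norm (ltW F0)) -sqrtr_sqr ler_wsqrtr //.
apply: lg2_le_inv; rewrite ?exprn_gt0 ?powR_gt0 //.
by rewrite lg2_exp lg2X // ltW.
Qed.

Lemma lg2_target (eps x y : R) : 0 < eps ->
  lg2 (eps ^+ 4 / (2 ^+ 16 * powR 2 (- x) * powR 2 y))
  = x - y - 4 * lg2 (1 / eps) - 16.
Proof.
move=> e0; have g x' : 0 < powR (2 : R) x' by exact: powR_gt0.
have p16 : 0 < (2 : R) ^+ 16 by rewrite exprn_gt0.
have q0 := mulr_gt0 (mulr_gt0 p16 (g (- x))) (g y).
rewrite lg2M ?exprn_gt0 ?invr_gt0 // (lg2V q0) (lg2M (mulr_gt0 p16 (g (- x))) (g y)).
rewrite (lg2M p16 (g (- x))) !lg2_exp (lg2X _ e0) (lg2X _ (ltr0n R 2)) lg2_2 div1r (lg2V e0).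
by ring.
Qed.

Lemma loewZ_le n (A B : 'M[C]_n) (l l' : R) : psd B -> l <= l' ->
  loew A (l%:C *: B) -> loew A (l'%:C *: B).
Proof.
move=> pB ll h; apply: loew_trans h _; rewrite /loew -scalerBl -rmorphB.
by apply: psdZ pB; rewrite subr_ge0.
Qed.

Lemma lg2_sup_infty (P : set nat) : (forall k, (0 < k)%N -> P k) ->
  ereal_sup [set (lg2 k%:R)%:E | k in [set k | (0 < k)%N /\ P k]] = +oo%E :> \bar R.
Proof.
move=> hP; set S := ereal_sup _.
have h n : (n%:R%:E <= S)%E.
  apply: ereal_sup_ubound; exists (2 ^ n)%N.
    by split; [rewrite expn_gt0|apply: hP; rewrite expn_gt0].
  by rewrite natrX lg2X // lg2_2 mulr1.
case: S h => [r| |] //= h; last by have := h 0%N; rewrite leeNy_eq.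
have := h (Num.Def.truncn r).+1; rewrite lee_fin => /(lt_le_trans (truncnS_gt r)).
by rewrite ltxx.
Qed.

(** Replaces possibly infinite entropies by real bounds [x < a] and [b < y]. The one-message code
    makes the supremum nonnegative, so only positive target rates need a construction. *)
Lemma code_bound (P : set nat) (a b : \bar R) (r : R) : P 1%N ->
  (forall x y : R, (x%:E < a)%E -> (b < y%:E)%E -> 0 < x - y - r - 16 ->
    exists k, [/\ (0 < k)%N, P k & x - y - r - 16 <= lg2 k%:R]) ->
  (a - b - r%:E - 16%:E <= ereal_sup [set (lg2 k%:R)%:E | k in [set k | (0 < k)%N /\ P k]])%E.
Proof.
move=> P1; set S := ereal_sup _ => h.
have ub k : (0 < k)%N -> P k -> ((lg2 k%:R)%:E <= S)%E.
  by move=> k0 Pk; apply: ereal_sup_ubound; exists k.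
have S0 : (0%:E <= S)%E by have := ub 1%N isT P1; rewrite lg2_1.
rewrite leNgt; apply/negP; rewrite lteBrDr // lteBrDr //.
clearbody S; case: S ub S0 => [c| |] ub S0; last 2 first.
  by rewrite /= ltNge leey.
  by rewrite leeNy_eq in S0.
rewrite lee_fin in S0; rewrite -!EFinD => hc.
have [x [y [xa yb hxy]]] := ereal_sub_gt hc.
have [|k [k0 Pk hk]] := h x y xa yb; first by clear -hxy S0; lra.
by have := ub k k0 Pk; rewrite lee_fin; clear -hxy hk; lra.
Qed.

Lemma distr_inhabited (T : finType) (P : T -> R) : isdistr P -> exists t : T, True.
Proof.
move=> [_ P1]; have [[t _]|no] := pselect (exists t : T, True); first by exists t.
move: P1; rewrite big1 => [/eqP|t _]; first by rewrite eq_sym oner_eq0.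
by case: no; exists t.
Qed.

Section Public.
Variables (X : finType) (eps : R) (d : nat) (th : X -> 'M[C]_d).
Hypotheses (e0 : 0 < eps) (qth : forall x, qstate (th x)).

Lemma pub_code1 (x0 : X) : pub_code eps th 1.
Proof.
exists (fun=> x0), (fun=> 1%:M); split.
  by split=> [m|]; [exact: psd1|rewrite big_ord1].
by move=> m; rewrite /perr mul1mx qstate_trR // subrr ltW.
Qed.

Lemma pub_code_trivial (x0 : X) k : 1 <= eps -> (0 < k)%N -> pub_code eps th k.
Proof.
move=> e1 k0; pose D (m : 'I_k) : 'M[C]_d := (k%:R^-1 : R)%:C *: 1%:M.
have ki0 : 0 <= k%:R^-1 :> R by rewrite invr_ge0.
exists (fun=> x0), D; split.
  split=> [m|]; first exact: psdZ ki0 (psd1 R d).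
  rewrite -scaler_suml -(rmorph_sum (real_complex R)) (proj2 (isdistr_unif R k0)).
  by rewrite (rmorph1 (real_complex R)) scale1r.
move=> m; apply: le_trans e1; rewrite /perr gerBl /D -scalemxAl mul1mx trRZ.
by rewrite qstate_trR // mulr1.
Qed.

Lemma public_direct :
  (ereal_sup [set (sHminU (eps / 8) (ptr2 (cqstate P th))
                      - sHmax (eps / 8) (cqstate P th)
                      - (4 * lg2 (1 / eps))%:E - 16%:E)%E
                 | P in [set P : X -> R | isdistr P]] <= Cpub eps th)%E.
Proof.
apply: ge_ereal_sup => _ [P hP <-]; have [x0 _] := distr_inhabited hP.
(* Every message number is allowed once [eps >= 1], and the capacity is infinite. *)
have [e1|e1] := leP 1 eps.
  by rewrite /Cpub lg2_sup_infty ?leey // => k; exact: pub_code_trivial.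
rewrite ptr2_cqstate // cqstateE.
pose p (i : 'I_#|X|) := P (enum_val i); pose ths (i : 'I_#|X|) := th (enum_val i).
have hp : isdistr p by split=> [i|]; [exact: (proj1 hP)|rewrite (sum_enum_val P); exact: (proj2 hP)].
apply: code_bound; first exact: pub_code1 x0.
move=> x y /ereal_sup_gt[_ [rb1 [sb1 near1] <-] hx] /ereal_inf_lt[_ [rb2 [sb2 near2] <-] hy] v0.
have [_ [l hl <-] ll] := ereal_inf_lt (elg2_inf_lt hx).
have g z : 0 < powR (2 : R) z by exact: powR_gt0.
have rl := loewZ_le (psd1 R _) (ltW ll) hl.
have [k [enc [D [k0 hk pD hD]]]] := @public_core R _ _ p ths rb1 rb2 eps (powR 2 (- x)) (powR 2 y)
   e0 e1 (g _) (g _) hp (fun i => qth _) sb1 near1 rl sb2 near2 (Hmax_lt_fid hy).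
exists k; split=> //.
  by exists (fun m => enum_val (enc m)), D; split.
rewrite -lg2_target //; apply: lg2_ler hk.
by rewrite divr_gt0 ?mulr_gt0 ?exprn_gt0.
Qed.
End Public.

Section Private.
Variables (X : finType) (eps : R) (dY dZ : nat) (th : X -> 'M[C]_(dY * dZ)).
Hypotheses (e0 : 0 < eps) (qth : forall x, qstate (th x)).

Lemma prv_code_const (x0 : X) k (e : R) (D : 'I_k -> 'M[C]_dY) : (0 < k)%N -> 0 <= e -> povm D ->
  (forall m, 1 - trR (D m *m ptr2 (th x0)) <= e) -> prv_code e th k.
Proof.
move=> k0 e0' pD hD; pose E (m : 'I_k) x : R := (x == x0)%:R.
have eE m : encout th E m = th x0.
  rewrite /encout (bigD1 x0) //= big1 => [|x /negPf xx0].
    by rewrite /E eqxx (rmorph1 (real_complex R)) scale1r addr0.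
  by rewrite /E xx0 (rmorph0 (real_complex R)) scale0r.
exists E, D; split; first move=> m.
  split=> [x|]; first by rewrite ler0n.
  by rewrite /E (bigD1 x0) //= eqxx big1 ?addr0 // => x /negPf ->.
split=> //; split=> m; first by rewrite eE.
under eq_bigr do rewrite eE.
rewrite eE sumr_const card_ord -[ptr1 (th x0) *+ k]scaler_nat scalerA mulVf ?scale1r ?subrr ?tnorm0 ?mul0r //.
by rewrite pnatr_eq0 -lt0n.
Qed.

Lemma prv_code1 (x0 : X) : prv_code (8 * eps) th 1.
Proof.
have e8 : 0 <= 8 * eps by rewrite mulr_ge0 // ltW.
apply: (@prv_code_const x0 1 _ (fun=> 1%:M)) => //.
  by split=> [m|]; [exact: psd1|rewrite big_ord1].
by move=> m; rewrite mul1mx (qstate_trR (qstate_ptr2 (qth x0))) subrr.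
Qed.

Lemma prv_code_trivial (x0 : X) k : 1 <= 8 * eps -> (0 < k)%N -> prv_code (8 * eps) th k.
Proof.
move=> e1 k0; have ki0 : 0 <= k%:R^-1 :> R by rewrite invr_ge0.
apply: (@prv_code_const x0 k _ (fun=> (k%:R^-1 : R)%:C *: 1%:M)) => //.
- exact: le_trans e1.
- split=> [m|]; first exact: psdZ ki0 (psd1 R dY).
  rewrite -scaler_suml -(rmorph_sum (real_complex R)) (proj2 (isdistr_unif R k0)).
  by rewrite (rmorph1 (real_complex R)) scale1r.
move=> m; apply: le_trans e1; rewrite gerBl -scalemxAl mul1mx trRZ.
by rewrite (qstate_trR (qstate_ptr2 (qth x0))) mulr1.
Qed.

Lemma private_core n (p : 'I_n -> R) (y : 'I_n -> 'M[C]_dY) (z : 'I_n -> 'M[C]_dZ)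
    (s : 'M[C]_dZ) (rb1 : 'M[C]_(n * dZ)) (rb2 : 'M[C]_(n * dY)) (lam mu : R) :
  eps < 1 / 8 -> 0 < lam -> 0 < mu ->
  isdistr p -> (forall i, qstate (y i)) -> (forall i, qstate (z i)) ->
  subnormalized rb1 -> pdist (bdiag (fun i => (p i)%:C *: z i)) rb1 <= eps / 8 ->
  qstate s -> loew rb1 (lam%:C *: tensmx 1%:M s) ->
  subnormalized rb2 -> pdist (bdiag (fun i => (p i)%:C *: y i)) rb2 <= eps / 8 ->
  (forall s : 'M[C]_dY, qstate s -> fid rb2 (tensmx 1%:M s) <= Num.sqrt mu) ->
  1 <= eps ^+ 4 / (2 ^+ 16 * lam * mu) ->
  exists k (q : 'I_k -> 'I_n -> R) (D : 'I_k -> 'M[C]_dY),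
  [/\ eps ^+ 4 / (2 ^+ 16 * lam * mu) <= k%:R, forall m, isdistr (q m), povm D,
     forall m, 1 - \sum_t q m t * trR (D m *m y t) <= 8 * eps &
     forall m, tnorm (\sum_t (q m t)%:C *: z t
         - (k%:R^-1 : R)%:C *: \sum_m' \sum_t (q m' t)%:C *: z t) / 2 <= 8 * eps].
Proof.
move=> e1 lam0 mu0 hp qy qz sb1 near1 qs rl sb2 near2 hfid V1.
have he0 := e0; have e'0 : 0 < eps / 8 by lra.
have [Lam [eL hL1 hL2]] := decoding_test hp qy sb2 mu0 e'0 near2 hfid.
have hmu := test_weight hp qy e'0 eL hL1 hL2.
have e20 : 0 < eps ^+ 2 by rewrite exprn_gt0.
have [L [L0 Lge Lle]] : exists L : nat,
   [/\ (0 < L)%N, 256 * mu / eps ^+ 2 <= L%:R & L%:R <= 2 * (256 * mu / eps ^+ 2)].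
  apply: nat_between; rewrite ler_pdivlMr // mul1r expr2.
  by move: he0 e1 hmu; nra.
have [k [k0 kge kle]] := nat_between V1.
have N0 : (0 < 2 * k)%N by rewrite muln_gt0.
(* The factor [2^16] is tight here: one factor 2 for the messages to be discarded, two from rounding
   [k] and [L], [256] from the bins and [32] from hashing multiply to [2^16]. *)
have Kle : (2 * k * L)%:R * lam <= eps ^+ 2 / 32.
  rewrite !natrM.
  apply: (@le_trans _ _ (2 * (2 * (eps ^+ 4 / (2 ^+ 16 * lam * mu))) * (2 * (256 * mu / eps ^+ 2)) * lam)).
    rewrite (ler_wpM2r (ltW lam0)) //; apply: ler_pM => //; rewrite ?mulr_ge0 //.
    by rewrite ler_pM2l.
  rewrite le_eqVlt; apply/orP; left; apply/eqP; field.
  by rewrite !gt_eqF.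
have [h hh] := private_hash hp qy qz eL N0 L0 e0 lam0 mu0 sb1 near1 qs rl hL1 hL2 Lge Kle.
have [k' [q [D [kk' hq pD h1 h2]]]] := private_extract hp qy qz eL k0 L0 e0 e1 hh.
exists k', q, D; split=> //.
by apply: le_trans kge _; rewrite ler_nat.
Qed.

Lemma private_direct :
  (ereal_sup [set r | exists (t : nat) (PT : 'I_t -> R) (W : 'I_t -> X -> R),
                   isdistr PT /\ (forall tau, isdistr (W tau)) /\
                   r = (sHmin (eps / 8) (ptrY (tstate PT W th))
                        - sHmax (eps / 8) (ptrZ (tstate PT W th))
                        - (4 * lg2 (1 / eps))%:E - 16%:E)%E]
        <= Cprv (8 * eps) th)%E.
Proof.
apply: ge_ereal_sup => _ [t [PT [W [hPT [hW ->]]]]].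
have [tau _] := distr_inhabited hPT; have [x0 _] := distr_inhabited (hW tau).
have [e1|e1] := leP 1 (8 * eps).
  by rewrite /Cprv lg2_sup_infty ?leey // => k; exact: prv_code_trivial.
have {}e1 : eps < 1 / 8 by have he0 := e0; lra.
pose om (i : 'I_#|'I_t|) := \sum_x (W (enum_val i) x)%:C *: th x.
pose p (i : 'I_#|'I_t|) := PT (enum_val i).
have qom i : qstate (om i) by exact: qstate_mix.
have hp : isdistr p by split=> [i|]; [exact: (proj1 hPT)|rewrite (sum_enum_val PT); exact: (proj2 hPT)].
have -> : ptrY (tstate PT W th) = bdiag (fun i => (p i)%:C *: ptr1 (om i)).
  by rewrite /tstate cqstateE ptrY_bdiag; apply: eq_bdiag => i; rewrite ptr1Z.
have -> : ptrZ (tstate PT W th) = bdiag (fun i => (p i)%:C *: ptr2 (om i)).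
  by rewrite /tstate cqstateE ptrZ_bdiag; apply: eq_bdiag => i; rewrite ptr2Z.
apply: code_bound; first exact: prv_code1 x0.
move=> x y /ereal_sup_gt[_ [rb1 [sb1 near1] <-] hx] /ereal_inf_lt[_ [rb2 [sb2 near2] <-] hy] v0.
have [_ [s qs <-] hs] := ereal_sup_gt hx.
have [_ [l hl <-] ll] := ereal_inf_lt (elg2_inf_lt hs).
have g z : 0 < powR (2 : R) z by exact: powR_gt0.
have pI : psd (tensmx (1%:M : 'M[C]_#|'I_t|) s).
  by rewrite tensmx1l; apply: psd_bdiag => _; case: qs.
have rl := loewZ_le pI (ltW ll) hl.
have V1 : 1 <= eps ^+ 4 / (2 ^+ 16 * powR 2 (- x) * powR 2 y).
  apply: lg2_le_inv => //; first by rewrite divr_gt0 ?mulr_gt0 ?exprn_gt0.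
  by rewrite lg2_target // lg2_1 ltW.
have [k [q [D [kge hq pD h1 h2]]]] := private_core e1 (g _) (g _) hp
  (fun i => qstate_ptr2 (qom i)) (fun i => qstate_ptr1 (qom i)) sb1 near1 qs rl sb2 near2
  (Hmax_lt_fid hy) V1.
have k0 : (0 < k)%N by rewrite -(ltr0n R); apply: lt_le_trans (le_trans V1 kge).
exists k; split=> //; last first.
  by rewrite -lg2_target //; apply: lg2_ler kge; rewrite divr_gt0 ?mulr_gt0 ?exprn_gt0.
(* The code for the channel from [T] is composed with the stochastic map from [T] to [X]; the output
   states are unchanged by linearity. *)
pose E m x' := \sum_i q m i * W (enum_val i) x'.
have eE m : encout th E m = \sum_i (q m i)%:C *: om i.
  rewrite /encout /E /om; under [RHS]eq_bigr do rewrite scaler_sumr.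
  rewrite [RHS]exchange_big; apply: eq_bigr => x' _.
  rewrite (rmorph_sum (real_complex R)) scaler_suml; apply: eq_bigr => i _.
  by rewrite scalerA -rmorphM.
exists E, D; split; first move=> m.
  split=> [x'|]; first by apply: sumr_ge0 => i _; apply: mulr_ge0; [case: (hq m)|case: (hW (enum_val i))].
  rewrite exchange_big /= -(proj2 (hq m)); apply: eq_bigr => i _.
  by rewrite -mulr_sumr (proj2 (hW _)) mulr1.
split; [exact: pD|split=> m].
  apply: le_trans (h1 m); rewrite eE ptr2_lin mulmx_sumr trR_sum.
  rewrite (eq_bigr (fun i => q m i * trR (D m *m ptr2 (om i)))) // => i _.
  by rewrite -scalemxAr trRZ.
apply: le_trans (h2 m); rewrite eE ptr1_lin.
rewrite [X in _ *: X](eq_bigr (fun m' => \sum_i (q m' i)%:C *: ptr1 (om i))).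
  by rewrite fmorphV rmorph_nat.
by move=> m' _; rewrite eE ptr1_lin.
Qed.
End Private.
End Main.

Theorem theorem1 (R : realType) (X : finType) (eps : R) (heps : 0 < eps) :
  (* public communication over x |-> theta_x^Y *)
  (forall (dY : nat) (th : X -> 'M[R[i]]_dY), (forall x, qstate (th x)) ->
     (ereal_sup [set (sHminU (eps / 8) (ptr2 (cqstate P th))
                      - sHmax (eps / 8) (cqstate P th)
                      - (4 * lg2 (1 / eps))%:E - 16%:E)%E
                 | P in [set P : X -> R | isdistr P]] <= Cpub eps th)%E /\
     (Cpub eps th <= ereal_sup [set (HminU (ptr2 (cqstate P th))
                      - sHmax (Num.sqrt (2 * eps)) (cqstate P th))%E
                 | P in [set P : X -> R | isdistr P]])%E) /\
  (* private communication over x |-> theta_x^{YZ} *)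
  (forall (dY dZ : nat) (th : X -> 'M[R[i]]_(dY * dZ)), (forall x, qstate (th x)) ->
     (ereal_sup [set r | exists (t : nat) (PT : 'I_t -> R) (W : 'I_t -> X -> R),
                   isdistr PT /\ (forall tau, isdistr (W tau)) /\
                   r = (sHmin (eps / 8) (ptrY (tstate PT W th))
                        - sHmax (eps / 8) (ptrZ (tstate PT W th))
                        - (4 * lg2 (1 / eps))%:E - 16%:E)%E]
        <= Cprv (8 * eps) th)%E /\
     (Cprv eps th <=
        ereal_sup [set r | exists (t : nat) (PT : 'I_t -> R) (W : 'I_t -> X -> R),
                   isdistr PT /\ (forall tau, isdistr (W tau)) /\
                   r = (sHmin (Num.sqrt (2 * eps)) (ptrY (tstate PT W th))
                        - sHmax (Num.sqrt (2 * eps)) (ptrZ (tstate PT W th)))%E])%E).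
Proof.
split=> [dY th qth|dY dZ th qth]; split.
- exact: public_direct.
- exact: public_converse.
- exact: private_direct.
exact: private_converse.
Qed.
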